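(* Let $\mathbf d_\kappa$, $\kappa\ge1$, be degree sequences such that the corresponding degree statistics $\mathbf n_{\mathbf d_\kappa}$ satisfy, as $\kappa\to\infty$, $|\mathbf d_\kappa|=|\mathbf n_{\mathbf d_\kappa}|\to\infty$ and $n_{\mathbf d_\kappa}(i)/|\mathbf d_\kappa|\to p_i$ for every $i\ge0$, where $\mathbf p=(p_i)_{i\ge0}$ is a probability distribution on $\mathbb N_0$. Let $\mathcal T^{\mathrm{lab}}_{\mathbf d_\kappa}\sim\mathrm{Unif}(\mathbb T^{\mathrm{lab}}_{\mathbf d_\kappa})$. Then for every fixed $T\in\mathbb T^{\mathrm{un}}$, as $\kappa\to\infty$: (i) (Annealed version) $\displaystyle\mathbb P(\mathcal T^{\mathrm{lab},\mathrm{fr}}_{\mathbf d_\kappa}=T)=\frac{\mathbb E[N_T(\mathcal T^{\mathrm{lab}}_{\mathbf d_\kappa})]}{|\mathbf d_\kappa|}\to\pi^{\mathrm{un}}_{\mathbf p}(T)$. (ii) (Quenched version) $\displaystyle\mathbb P(\mathcal T^{\mathrm{lab},\mathrm{fr}}_{\mathbf d_\kappa}=T\mid\mathcal T^{\mathrm{lab}}_{\mathbf d_\kappa})=\frac{N_T(\mathcal T^{\mathrm{lab}}_{\mathbf d_\kappa})}{|\mathbf d_\kappa|}\to\pi^{\mathrm{un}}_{\mathbf p}(T)$ in probability. In other words, the random fringe tree converges in distribution: (i) says that $\mathcal T^{\mathrm{lab},\mathrm{fr}}_{\mathbf d_\kappa}$ converges in distribution to $\mathcal T^{\mathrm{un}}_{\mathbf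 p}$, and (ii) is the conditional version, that the conditional law $\mathcal L(\mathcal T^{\mathrm{lab},\mathrm{fr}}_{\mathbf d_\kappa}\mid\mathcal T^{\mathrm{lab}}_{\mathbf d_\kappa})$ converges in probability to $\mathcal L(\mathcal T^{\mathrm{un}}_{\mathbf p})$.
   Context: $\mathbb N_0=\{0,1,2,\dots\}$. The degree of a vertex in a rooted tree is its number of children. A degree sequence of length $n\ge1$ is $\mathbf d=(d_1,\dots,d_n)\in\mathbb N_0^n$ with $\sum_{i=1}^n d_i=n-1$; $|\mathbf d|:=n$. Its degree statistic is $\mathbf n_{\mathbf d}=(n_{\mathbf d}(i))_{i\ge0}$, $n_{\mathbf d}(i):=|\{v\in\{1,\dots,n\}:d_v=i\}|$, and $|\mathbf n_{\mathbf d}|:=\sum_i n_{\mathbf d}(i)=|\mathbf d|$. $\mathbb T^{\mathrm{lab}}_{\mathbf d}$ is the set of unordered rooted trees with vertices labelled $1,\dots,|\mathbf d|$ in which vertex $i$ has degree $d_i$ for every $i$; $\mathrm{Unif}(\mathbb T^{\mathrm{lab}}_{\mathbf d})$ is the uniform distribution on it. $\mathbb T^{\mathrm{un}}$ is the set of finite unordered unlabelled rooted trees. For a labelled tree $T$ and a vertex $v$, the fringe subtree $T_v\in\mathbb T^{\mathrm{un}}$ consists of $v$ and all its descendants, rooted at $v$, with labels ignored. For $T'\in\mathbb T^{\mathrm{un}}$, $N_{T'}(T):=|\{v\in T:T_v=T'\}|$ (equality meaning isomorphism). $\mathcal T^{\mathrm{lab},\mathrm{fr}}_{\mathbf d}$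 is the fringe subtree of $\mathcal T^{\mathrm{lab}}_{\mathbf d}$ at a vertex that, given $\mathcal T^{\mathrm{lab}}_{\mathbf d}$, is uniformly random. $\mathcal T^{\mathrm{un}}_{\mathbf p}$ is a Galton--Watson tree with offspring distribution $\mathbf p$, regarded as an unordered tree, and $\pi^{\mathrm{un}}_{\mathbf p}(T):=\mathbb P(\mathcal T^{\mathrm{un}}_{\mathbf p}=T)=|\mathrm{Ord}(T)|\prod_{i\ge0}p_i^{n_T(i)}$, where $n_T(i)$ is the number of vertices of $T$ of degree $i$, $0^0:=1$, and $\mathrm{Ord}(T)$ is the set of plane (ordered) rooted trees (up to isomorphism) that reduce to $T$ when the ordering is ignored. $\mathcal L(X)$ denotes the distribution of $X$.
   Formalization: The closing ''in other words'' statement on convergence in distribution is proved for p_1 ≠ 1 only; if p_1 = 1 the Galton–Watson tree is a.s. an infinite path, not in T^un, so the sentence has no literal meaning there. Parts (i) and (ii) are unrestricted. *)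

(* Defs.v *)
From HB Require Import structures.
From mathcomp Require Import all_boot all_order all_algebra finmap generic_quotient.
From mathcomp Require Import all_classical all_reals all_analysis.

Set Implicit Arguments.
Unset Strict Implicit.
Unset Printing Implicit Defensive.

Import Order.TTheory GRing.Theory Num.Theory.
Import numFieldNormedType.Exports.

Local Open Scope classical_set_scope.
Local Open Scope ring_scope.

Inductive ptree : Type := PNode of seq ptree.

(* The automatically generated principle has no hypothesis on the subtrees. *)
Lemma ptree_ind_all (Q : ptree -> Prop) :
  (forall s, foldr (fun t A => Q t /\ A) True s -> Q (PNode s)) ->
  forall t, Q t.
Proof.
move=> H; fix IH 1; case=> s; apply: H.
by elim: s => [//|t s IHs] /=; split; [exact: IH | exact: IHs].
Qed.

Fixpoint gentree_of_ptree (t : ptree) : GenTree.tree void :=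
  let: PNode s := t in GenTree.Node 0 (map gentree_of_ptree s).

Fixpoint ptree_of_gentree (t : GenTree.tree void) : ptree :=
  match t with
  | GenTree.Leaf _ => PNode [::]
  | GenTree.Node _ s => PNode (map ptree_of_gentree s)
  end.

Lemma gentree_of_ptreeK : cancel gentree_of_ptree ptree_of_gentree.
Proof.
elim/ptree_ind_all => s IH /=; congr PNode.
by elim: s IH => //= t s IHs [-> /IHs ->].
Qed.

HB.instance Definition _ := Countable.copy ptree (can_type gentree_of_ptreeK).

Lemma ptree_ind_mem (Q : ptree -> Prop) :
  (forall s, (forall t, t \in s -> Q t) -> Q (PNode s)) -> forall t, Q t.
Proof.
move=> H; elim/ptree_ind_all => s IH; apply: H.
elim: s IH => //= t s IHs [Qt /IHs Qs] u; rewrite inE => /predU1P[-> //|].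
exact: Qs.
Qed.

(* In preorder. *)
Fixpoint ptree_degrees (t : ptree) : seq nat :=
  let: PNode s := t in size s :: flatten (map ptree_degrees s).

Definition ptree_size (t : ptree) : nat := size (ptree_degrees t).

(* Two plane trees carry the same unordered tree iff the subtrees at the
   children of the two roots can be matched bijectively so that matched
   subtrees carry the same unordered tree. *)
Fixpoint uiso (t1 t2 : ptree) : bool :=
  let: PNode s1 := t1 in let: PNode s2 := t2 in
  has (fun s => all2 uiso s1 s) (permutations s2).

Lemma all2_perm (A B : eqType) (r : A -> B -> bool) s t u :
  all2 r s t -> perm_eq t u -> exists2 s', perm_eq s s' & all2 r s' u.
Proof.
move=> rst ptu; have szst : size s = size t.
  by elim: s t rst {ptu} => [|x s IH] [|y t] //= /andP[_ /IH ->].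
case: s => [|x0 s] in szst rst *.
  case: t szst rst ptu => // _ _.
  by rewrite perm_sym => /perm_nilP ->; exists [::].
case: t => // y0 t in szst rst ptu *.
have [Is pIs eu] : exists2 Is, perm_eq (iota 0 (size (y0 :: t))) Is
    & u = [seq nth y0 (y0 :: t) i | i <- Is].
  by move: ptu; rewrite perm_sym => /(perm_iotaP y0)[Is]; rewrite perm_sym; exists Is.
exists [seq nth x0 (x0 :: s) i | i <- Is].
  rewrite perm_sym; apply/(perm_iotaP x0); exists Is => //.
  by rewrite szst perm_sym.
have H i : i \in Is -> r (nth x0 (x0 :: s) i) (nth y0 (y0 :: t) i).
  rewrite -(perm_mem pIs) mem_iota add0n => /= lti.
  move: rst; rewrite all2E => /andP[_ /(all_nthP (x0, y0))/(_ i)].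
  by rewrite size_zip szst minnn nth_zip//; apply.
rewrite eu; elim: Is H {pIs eu} => //= i Is IH H.
by rewrite H ?mem_head//=; apply: IH => j jIs; apply: H; rewrite inE jIs orbT.
Qed.

Lemma uisoE s1 s2 :
  uiso (PNode s1) (PNode s2) <-> exists2 s, perm_eq s s2 & all2 uiso s1 s.
Proof.
split=> [/hasP[s]|[s ps us]]; first by rewrite mem_permutations; exists s.
by apply/hasP; exists s => //; rewrite mem_permutations.
Qed.

Lemma uiso_refl : reflexive uiso.
Proof.
elim/ptree_ind_mem => s IH; apply/uisoE; exists s => //.
elim: s IH => //= t s IHs IH; rewrite IH ?mem_head//=.
by apply: IHs => u us; apply: IH; rewrite inE us orbT.
Qed.

Lemma uiso_sym : symmetric uiso.
Proof.
suff H t1 t2 : uiso t1 t2 -> uiso t2 t1 by move=> t1 t2; apply/idP/idP => /H.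
elim/ptree_ind_mem: t1 t2 => s1 IH [s2] /uisoE[s ps us].
have us' : all2 uiso s s1.
  elim: s1 s us IH {ps} => [|x s1 IHs] [|y s] //= /andP[xy ys] IH.
  rewrite IH ?mem_head//=; apply: IHs => // z zs1.
  by apply: IH; rewrite inE zs1 orbT.
have us2 : exists2 s', perm_eq s1 s' & all2 uiso s2 s'.
  have [s'' p1 a1] : exists2 s'', perm_eq s1 s'' & all2 (fun x y => uiso y x) s'' s2.
    apply: (all2_perm _ ps).
    elim: s s1 us' {IH ps us} => [|x s IHs] [|y s1] //= /andP[-> /IHs]//.
  exists s'' => //; elim: s'' s2 a1 {p1 ps} => [|x s'' IHs] [|y s2] //= /andP[-> /IHs]//.
by have [s' p1 a1] := us2; apply/uisoE; exists s' => //; rewrite perm_sym.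
Qed.

Lemma uiso_trans : transitive uiso.
Proof.
move=> t2 t1 t3; elim/ptree_ind_mem: t1 t2 t3 => s1 IH [s2] [s3].
move=> /uisoE[s p12 a1] /uisoE[s' p23 a2]; apply/uisoE.
have [u pu au] : exists2 u, perm_eq s' u & all2 uiso s u.
  have a2' : all2 (fun x y => uiso y x) s' s2.
    by elim: s' s2 a2 {p23 p12} => [|x s' IHs] [|y s2] //= /andP[-> /IHs].
  rewrite perm_sym in p12; have [u pu au] := all2_perm a2' p12.
  exists u => //; elim: u s au {pu a1 p12} => [|x u IHs] [|y s] //= /andP[-> /IHs]//.
exists u; first by rewrite (perm_trans _ p23)// perm_sym.
elim: s1 s u a1 au IH {p12 pu} => [|x s1 IHs] [|y s] [|z u] //=.
move=> /andP[xy a1] /andP[yz a2'] IH; rewrite (IH _ _ _ _ xy yz) ?mem_head//=.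
by apply: IHs a1 a2' _ => w ws; apply: IH; rewrite inE ws orbT.
Qed.

Canonical uiso_equiv := EquivRel uiso uiso_refl uiso_sym uiso_trans.

Definition utree := {eq_quot uiso_equiv}%qT.
HB.instance Definition _ := Choice.on utree.
HB.instance Definition _ := EqQuotient.on utree.

Definition forget_order (t : ptree) : utree := (\pi_utree t)%qT.

Definition Ord (T : utree) : set ptree := [set t | forget_order t = T].

Lemma forget_order_eq t1 t2 : forget_order t1 = forget_order t2 <-> uiso t1 t2.
Proof. by split=> /eqmodP. Qed.

Lemma uiso_degrees t1 t2 :
  uiso t1 t2 -> perm_eq (ptree_degrees t1) (ptree_degrees t2).
Proof.
elim/ptree_ind_mem: t1 t2 => s1 IH [s2] /uisoE[s ps us] /=.
have -> : size s1 = size s2.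
  by rewrite -(perm_size ps); move: us; rewrite all2E => /andP[/eqP].
rewrite perm_cons; apply: (@perm_trans _ (flatten (map ptree_degrees s))).
  elim: s1 s us IH {ps} => [|x s1 IHs] [|y s] //= /andP[xy us] IH.
  apply: perm_cat; first by apply: IH; rewrite ?mem_head.
  by apply: IHs => // z zs1; apply: IH; rewrite inE zs1 orbT.
exact/perm_flatten/perm_map.
Qed.

(* n_T(i); by uiso_degrees it does not depend on the representative. *)
Definition utree_degstat (T : utree) (i : nat) : nat :=
  count_mem i (ptree_degrees (repr T)).

Definition utree_size (T : utree) : nat := ptree_size (repr T).

Lemma Ord_degrees (T : utree) t :
  Ord T t -> perm_eq (ptree_degrees t) (ptree_degrees (repr T)).
Proof.
move=> tT; apply: uiso_degrees; apply/forget_order_eq.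
by rewrite tT /forget_order reprK.
Qed.

Lemma finite_ptree_size n : finite_set [set t | (ptree_size t <= n)%N].
Proof.
suff [l Hl] : exists l : seq ptree, forall t, (ptree_size t <= n)%N -> t \in l.
  by apply: (sub_finite_set _ (finite_seq l)) => t /Hl.
elim: n => [|n [l Hl]]; first by exists [::] => -[].
pose seqs m := iter m (fun L => [::] :: [seq x :: r | x <- l, r <- L]) [:: [::]].
exists (map PNode (seqs n)) => -[s]; rewrite /ptree_size/= ltnS => sn.
apply: map_f; move: sn.
have : (size (flatten (map ptree_degrees s)) <= n)%N ->
    (size s <= n)%N /\ {subset s <= l}.
  elim: s => [|x s IH] //=; rewrite size_cat => H.
  have xgt0 : (0 < size (ptree_degrees x))%N by case: (x).
  have [_ sl] := IH (leq_trans (leq_addl _ _) H).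
  split; last first.
    move=> y; rewrite inE => /predU1P[->|/sl//].
    by apply: Hl; rewrite /ptree_size (leq_trans (leq_addr _ _) H).
  apply: (leq_trans _ H); rewrite -add1n leq_add//.
  elim: s {IH H sl} => //= y s IH; rewrite size_cat -add1n leq_add//.
  by case: (y).
move=> /[apply] -[]; elim: s n {Hl} @seqs => [|x s IH] [|n] //= sn sl.
rewrite inE; apply/orP; right; apply: allpairs_f; first exact/sl/mem_head.
by apply: IH => // y ys; apply: sl; rewrite inE ys orbT.
Qed.

Lemma finite_Ord (T : utree) : finite_set (Ord T).
Proof.
apply: sub_finite_set (finite_ptree_size (utree_size T)) => t /Ord_degrees.
by rewrite /utree_size/ptree_size /= => /perm_size ->.
Qed.

(* The factors with i >= |T| are equal to 1. *)
Definition piun (R : realType) (p : nat -> R) (T : utree) : R :=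
  #|` fset_set (Ord T)|%:R *
  \prod_(i < utree_size T) p i ^+ utree_degstat T i.

(* The descendants of v are kept down to depth h only. *)
Fixpoint unfold_tree (V : Type) (ch : V -> seq V) (h : nat) (v : V) : ptree :=
  if h is h'.+1 then PNode [seq unfold_tree ch h' w | w <- ch v] else PNode [::].

Section LabelledTrees.
Variable V : finType.
Implicit Type f : {ffun V -> option V}.

(* f is the parent function of a rooted tree with vertex set V. *)
Definition is_rooted_tree f : bool :=
  [exists r, (f r == None) &&
     [forall v, connect [rel x y | f x == Some y] v r]].

Definition children f (v : V) : seq V := [seq w <- enum V | f w == Some v].

(* A tree on V has no descending path with more than #|V| vertices, so that
   truncating at depth #|V| loses nothing. *)
Lemma unfold_children f v : is_rooted_tree f ->
  unfold_tree (children f) #|V| v =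
  PNode [seq unfold_tree (children f) #|V| w | w <- children f v].
Proof.
move=> /existsP[r /andP[/eqP fr /forallP rP]].
pose e := [rel x y | f x == Some y].
have path_uniq x s1 s2 : path e x s1 -> last x s1 = r ->
    path e x s2 -> last x s2 = r -> s1 = s2.
  elim: s1 x s2 => [|y s1 IH] x [|z s2] //=.
  - by move=> _ -> /andP[]; rewrite fr.
  - by move=> /andP[/[swap] _ fx] _ _ xr; move: fx; rewrite xr fr.
  move=> /andP[/eqP fx p1] l1 /andP[/eqP fx' p2] l2.
  have yz : y = z by move: fx'; rewrite fx => -[].
  by rewrite -yz in p2 l2 *; congr cons; exact: IH p2 l2.
have path_short x s : path e x s -> last x s = r -> (size s < #|V|)%N.
  move=> ps ls; have [s' [ps' us' ls']] : exists s',
      [/\ path e x s', uniq (x :: s') & last x s' = r].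
    by case/shortenP: ps ls => s' ps' us' _ ls; exists s'.
  rewrite (path_uniq _ _ _ ps ls ps' ls') -ltnS -/(size (x :: s')) ltnS.
  by rewrite -(card_uniqP us') max_card.
have agree h h' x s : path e x s -> last x s = r ->
    (#|V| <= h + size s)%N -> (#|V| <= h' + size s)%N ->
    unfold_tree (children f) h x = unfold_tree (children f) h' x.
  elim: h h' x s => [|h IH] [|h'] x s ps ls //=;
    try by rewrite add0n leqNgt (path_short x s ps ls).
    by move=> _; rewrite add0n leqNgt (path_short x s ps ls).
  rewrite !addSn -!addnS => hs hs'; congr PNode; apply/eq_in_map => w.
  rewrite mem_filter => /andP[fw _].
  by apply: (IH h' w (x :: s)) => //=; rewrite fw.
have /connectP[s ps /esym ls] := rP v.
have -> : unfold_tree (children f) #|V| v = unfold_tree (children f) #|V|.+1 v.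
  by apply: agree ps ls _ _; rewrite ?addSn ?leq_addr// ltnW// ltnS leq_addr.
by [].
Qed.

Definition fringe f (v : V) : utree :=
  forget_order (unfold_tree (children f) #|V| v).

Definition fringe_count (T : utree) f : nat := #|[pred v | fringe f v == T]|.

End LabelledTrees.

Definition degree_sequence (d : seq nat) : Prop :=
  (0 < size d)%N /\ sumn d = (size d).-1.

Definition degstat (d : seq nat) (i : nat) : nat := count_mem i d.

Definition labtree_pred (d : seq nat)
    (f : {ffun 'I_(size d) -> option 'I_(size d)}) : bool :=
  is_rooted_tree f && [forall i, size (children f i) == nth 0%N d i].

Definition labtree (d : seq nat) := {f | @labtree_pred d f}.
HB.instance Definition _ d := Finite.on (labtree d).

Section Probability.
Context d (Omega : measurableType d) (R : realType) (P : probability Omega R).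

Definition uniform_element (E : finType) (X : Omega -> E) : Prop :=
  forall x, measurable (X @^-1` [set x]) /\
            P (X @^-1` [set x]) = (#|E|%:R^-1)%:E.

(* Conditionally on X, the element U of F is uniformly distributed. *)
Definition cond_uniform_element (E F : finType) (X : Omega -> E)
    (U : Omega -> F) : Prop :=
  forall x u, measurable (U @^-1` [set u]) /\
    P (X @^-1` [set x] `&` U @^-1` [set u]) =
    (P (X @^-1` [set x]) * (#|F|%:R^-1)%:E)%E.

(* P(A | X) for a random element X with finitely many values. *)
Definition cond_prob (E : finType) (A : set Omega) (X : Omega -> E)
    (w : Omega) : R :=
  fine (P (A `&` X @^-1` [set X w])) / fine (P (X @^-1` [set X w])).

(* The number of children of each word of the Ulam--Harris tree: independent
   variables with common distribution p (the product rule contains both). *)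
Definition gw_offspring (p : nat -> R) (xi : seq nat -> Omega -> nat) : Prop :=
  (forall u i, measurable (xi u @^-1` [set i])) /\
  (forall (us : seq (seq nat)) (i : seq nat -> nat), uniq us ->
     P (\bigcap_(u in [set` us]) xi u @^-1` [set i u]) =
     (\prod_(u <- us) p (i u))%:E).

End Probability.

Definition gw_truncation (xi : seq nat -> nat) (h : nat) : ptree :=
  unfold_tree (fun u => [seq rcons u i | i <- iota 0 (xi u)]) h [::].

(* The Galton--Watson tree, as an unordered tree, is T. An infinite tree has
   infinitely many pairwise different truncations, so then no T qualifies; this
   happens almost surely if p 1 = 1. *)
Definition gw_is (xi : seq nat -> nat) (T : utree) : Prop :=
  \forall h \near \oo, forget_order (gw_truncation xi h) = T.

Definition gw_event (Omega : Type) (xi : seq nat -> Omega -> nat)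
    (A : set utree) : set Omega :=
  [set w | exists2 T, A T & gw_is (fun u => xi u w) T].

Definition fringe_event (Omega : Type) (d : seq nat) (X : Omega -> labtree d)
    (U : Omega -> 'I_(size d)) (A : set utree) : set Omega :=
  [set w | A (fringe (val (X w)) (U w))].

Definition cvg_in_probability (R : realType) (disp : nat -> measure_display)
    (Omega : forall k, measurableType (disp k))
    (P : forall k, probability (Omega k) R) (Y : forall k, Omega k -> R)
    (c : R) : Prop :=
  forall eps : R, 0 < eps ->
    P k [set w | eps <= `|Y k w - c|] @[k --> \oo] --> 0%E.

(* Main.v *)
Require Import Defs.
From mathcomp Require Import all_boot all_order all_algebra.
From mathcomp Require Import all_classical all_reals all_analysis.
From mathcomp Require Import measurable_realfun ring lra zify.

Set Implicit Arguments.
Unset Strict Implicit.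
Unset Printing Implicit Defensive.

Import Order.TTheory GRing.Theory Num.Theory numFieldNormedType.Exports.

(** Why the theorem is true.  For a fixed tree, let [n] be the number of
    vertices of the random labelled tree and [m] the number of vertices of [T].

    The children of a vertex of a labelled tree carry no order, and the formula
    for the limit counts ordered trees, so a random order is added.  A slot is a
    pair of a vertex [v] and a number smaller than the degree of [v]; a slot tree
    puts every vertex but the root into a slot of its own, the owner of the slot
    being the parent.  Every labelled tree underlies the same number of slot
    trees ([card_slot_tree_over]), so a uniform labelled tree is the shadow of a
    uniform slot tree.  Slot trees are easy to count, because removing a leaf
    together with its slot is a bijection ([card_slot_tree_leaf]): whatever the
    degrees, [k] prescribed vertices occupy [k] prescribed slots with probability
    one over the falling factorial [(n - 1) ^_ k], provided that they can be
    removed one after the other as leaves ([card_slot_tree_holds]).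

    Fringe subtrees equal to [T] correspond to words: lists of [m] vertices, in
    the order of a depth-first exploration, whose degrees spell the preorder
    degree sequence of one of the plane trees in [Ord T]
    ([fringe_count_words]).  The expected proportion of such vertices is
    therefore the number of repetition-free words divided by [n ^_ m]
    ([mean_fringe_count]), and it tends to the sum over [Ord T] of the products
    of the [p i], which is [piun p T] ([cvg_word_count], [piunE]).  Two words that
    occur in the same slot tree are equal or disjoint ([tree_word_meet]), and
    disjoint words are asymptotically uncorrelated, so the variance vanishes
    ([mean_fringe_count2], [cvg_mean_sq]).  Hence the proportion converges in mean
    ([cvg_mean_dist]), which contains both the annealed and the quenched
    statement ([cvg_annealed], [cvg_quenched]).

    On the side of the Galton--Watson tree, the event that the tree is [T] is the
    disjoint union, over the plane trees in [Ord T], of events that prescribe the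
    numbers of children of finitely many individuals ([prob_gw_event1]).  As the
    degrees of a tree with [n] vertices add up to [n - 1], the mean of [p] is at
    most 1 ([limit_mean_le1]); so if [p 1] is not 1, the Galton--Watson tree is
    finite almost surely ([gw_finite]).  No mass escapes then, and convergence on
    the individual trees implies convergence on every set of trees
    ([additive_prob_dist], [cvg_dist]). *)

(** * Slot trees *)

Section SlotTrees.
Variables (V S : finType) (own : S -> V).
Implicit Types (F : {ffun V -> option S}) (W : {set V}) (L : {set S}).

(** [own] maps a slot to the vertex that owns it; the vertex occupying the slot
    is then a child of the owner. *)
Definition parent_rel F : rel V := [rel x y | omap own (F x) == Some y].

(** Vertices outside [W] are dead; they get [None], like the root.  Restricting
    to subsets of fixed types lets leaves be removed without changing types. *)
Definition is_slot_tree W L F : Prop :=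
  [/\ forall v, v \notin W -> F v = None,
      forall v s, F v = Some s -> s \in L,
      forall u v s, F u = Some s -> F v = Some s -> u = v &
      exists r, [/\ r \in W, F r = None &
                    forall v, v \in W -> connect (parent_rel F) v r]].

Definition slot_tree W L : pred {ffun V -> option S} :=
  fun F => `[< is_slot_tree W L F >].

Definition set_slot F l (o : option S) : {ffun V -> option S} :=
  [ffun v => if v == l then o else F v].

Lemma parent_relP F x y :
  reflect (exists2 s, F x = Some s & own s = y) (parent_rel F x y).
Proof.
rewrite /parent_rel /=; case: (F x) => [s|] /=; last by constructor => -[].
apply: (iffP eqP) => [[<-]|[_ [->] <-//]]; by exists s.
Qed.

Lemma slot_tree_detach W L F l s :
  (forall s', s' \in L -> own s' != l) -> F l = Some s ->
  is_slot_tree W L F -> is_slot_tree (W :\ l) (L :\ s) (set_slot F l None).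
Proof.
move=> Hl Fl [F1 F2 F3 [r [rW Fr rP]]]; split.
- move=> v; rewrite !inE negb_and negbK ffunE; case: eqP => //= _; exact: F1.
- move=> v s'; rewrite ffunE; case: eqP => //= /eqP vl Fv; rewrite !inE (F2 _ _ Fv) andbT.
  by apply: contra vl => /eqP es; rewrite es in Fv; rewrite (F3 _ _ _ Fv Fl).
- move=> u v s'; rewrite !ffunE; case: eqP => // _; case: eqP => // _; exact: F3.
have rl : r != l by apply: contra_eq_neq Fr => ->; rewrite Fl.
exists r; split; [by rewrite !inE rl| by rewrite ffunE (negPf rl)|].
move=> v; rewrite !inE => /andP[vl vW]; have /connectP[q pq ->] := rP v vW.
apply/connectP; exists q => //; elim: q v vl pq {vW} => //= y q IH v vl /andP[e pq].
have /parent_relP[s' Fv os'] := e; apply/andP; split.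
  by apply/parent_relP; exists s' => //; rewrite ffunE (negPf vl).
by apply: IH => //; rewrite -os'; apply: Hl; apply: F2 Fv.
Qed.

Lemma slot_tree_attach W L F l s :
  l \in W -> s \in L -> own s \in W -> own s != l ->
  is_slot_tree (W :\ l) (L :\ s) F -> is_slot_tree W L (set_slot F l (Some s)).
Proof.
move=> lW sL osW osl [F1 F2 F3 [r [rW Fr rP]]].
have Fl : F l = None by apply: F1; rewrite !inE eqxx.
have Fs v : F v = Some s -> False by move=> /F2; rewrite !inE eqxx.
move: rW; rewrite !inE => /andP[rl rW].
have sub : subrel (connect (parent_rel F)) (connect (parent_rel (set_slot F l (Some s)))).
  apply: connect_sub => x y /parent_relP[s' Fx <-]; apply/connect1/parent_relP.
  exists s' => //; rewrite ffunE; case: eqP => // e; by rewrite e Fl in Fx.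
split.
- move=> v vW; rewrite ffunE ifN; last by apply: contraNneq vW => ->.
  by apply: F1; rewrite !inE (negPf vW) andbF.
- move=> v s'; rewrite ffunE; case: eqP => [_ [<-//]|_ /F2].
  by rewrite !inE => /andP[].
- move=> u v s'; rewrite !ffunE; case: eqP => [->|_]; case: eqP => [->|_] //.
  + by move=> [<-] /Fs.
  + by move=> /[swap] -[<-] /Fs.
  + exact: F3.
exists r; split; rewrite ?ffunE ?(negPf rl)// => v vW.
have [->|vl] := eqVneq v l; last by apply/sub/rP; rewrite !inE vl vW.
apply: (@connect_trans _ _ (own s)); last by apply/sub/rP; rewrite !inE osl.
by apply/connect1/parent_relP; exists s; rewrite // ffunE eqxx.
Qed.

(** [slot_tree_detach] and [slot_tree_attach] are inverse to each other.  The
    count on the right depends on [s] only through sizes when [Q] is trivial, so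
    every slot is equally likely to carry [l]. *)
Lemma card_slot_tree_leaf W L l s (Q : pred {ffun V -> option S}) :
  l \in W -> (forall s', s' \in L -> own s' != l) -> s \in L -> own s \in W ->
  (forall F o, Q (set_slot F l o) = Q F) ->
  #|[pred F | [&& slot_tree W L F, F l == Some s & Q F]]| =
  #|[pred F | slot_tree (W :\ l) (L :\ s) F && Q F]|.
Proof.
move=> lW Hl sL osW QE.
have Fl F : slot_tree (W :\ l) (L :\ s) F -> F l = None.
  by case/asboolP => F1 _ _ _; apply: F1; rewrite !inE eqxx.
pose attach F := set_slot F l (Some s).
have inj : {in [pred F | slot_tree (W :\ l) (L :\ s) F && Q F] &, injective attach}.
  move=> F F'; rewrite !inE => /andP[/Fl Fl1 _] /andP[/Fl Fl2 _] /ffunP e.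
  apply/ffunP => v; have := e v; rewrite !ffunE; case: eqP => // -> _.
  by rewrite Fl1 Fl2.
rewrite -(card_in_image inj); apply: eq_card => F; rewrite !inE; apply/idP/idP.
  move=> /and3P[/asboolP FT /eqP FE QF]; apply/fintype.imageP; exists (set_slot F l None).
    rewrite inE QE QF andbT; apply/asboolP; exact: slot_tree_detach.
  by apply/ffunP => v; rewrite !ffunE; case: eqP => // ->.
move=> /fintype.imageP[F']; rewrite inE => /andP[/asboolP F'T QF'] ->.
rewrite QE QF' ffunE eqxx eqxx /= andbT; apply/asboolP.
by apply: slot_tree_attach => //; exact: Hl.
Qed.

Lemma slot_tree_leaf_occupied W L F l s :
  is_slot_tree W L F -> l \in W -> (forall s', s' \in L -> own s' != l) ->
  s \in L -> own s \in W -> F l != None.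
Proof.
move=> [F1 F2 F3 [r [rW Fr rP]]] lW Hl sL osW; apply/eqP => Fl.
have /connectP[[|y q] /=] := rP _ lW; last first.
  by move=> /andP[/parent_relP[s']]; rewrite Fl.
move=> _ rl; have /connectP[q pq e] := rP _ osW.
case/lastP: q pq e => [|q y] /=; first by move=> _ e; have := Hl _ sL; rewrite -e rl eqxx.
rewrite rcons_path last_rcons => /andP[_ /parent_relP[s' /F2/Hl /eqP os' <-]] e.
by apply: os'; rewrite -e.
Qed.

(** There are fewer slots than vertices, so some vertex owns none. *)
Lemma exists_leaf W L : #|W| = #|L|.+1 ->
  exists2 l, l \in W & forall s, s \in L -> own s != l.
Proof.
move=> cWL; suff /subsetPn[l lW lL] : ~~ (W \subset own @: L)%SET.
  exists l => // s sL; apply: contraNneq lL => <-; exact: imset_f.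
apply/negP => /subset_leq_card; rewrite cWL => /leq_trans/(_ (leq_imset_card _ _)).
by rewrite ltnn.
Qed.

Lemma slots_in_detach W L l s : (forall s', s' \in L -> own s' \in W) ->
  (forall s', s' \in L -> own s' != l) ->
  forall s', s' \in (L :\ s)%SET -> own s' \in (W :\ l)%SET.
Proof.
by move=> LW Hl s'; rewrite !inE => /andP[_ s'L]; rewrite LW ?Hl.
Qed.

(** A leaf can sit in any of the slots, and removing it leaves a tree with one
    slot less. *)
Lemma card_slot_tree W L : (forall s, s \in L -> own s \in W) ->
  #|W| = #|L|.+1 -> #|slot_tree W L| = (#|L|)`!.
Proof.
move=> LW cW; move cL : #|L| => n; elim: n W L cL LW cW => [|n IH] W L cL LW.
  rewrite cL => /eqP/cards1P[v Wv]; rewrite fact0.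
  have L0 : L = finset.set0 by apply/eqP; rewrite -cards_eq0 cL.
  rewrite -(card1 ([ffun=> None] : {ffun V -> option S})); apply: eq_card => F.
  rewrite -[LHS]/(slot_tree W L F) [RHS]inE.
  apply/asboolP/eqP => [[F1 F2 F3 _]|->].
    apply/ffunP => u; rewrite ffunE; case E : (F u) => [s|//].
    by have := F2 _ _ E; rewrite L0 inE.
  split; do ?[by move=> *; rewrite ffunE | by move=> u s; rewrite ffunE | by move=> u u' s; rewrite ffunE].
  exists v; split; rewrite ?Wv ?inE ?ffunE// => u; rewrite inE => /eqP->; exact: connect0.
move=> cW; have [l lW Hl] := exists_leaf cW.
have [s0 s0L] : exists s, s \in L by apply/card_gt0P; rewrite cL.
transitivity (\sum_(s in L) #|[pred F | [&& slot_tree W L F, F l == Some s & true]]|)%N.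
  rewrite -sum1_card.
  rewrite (partition_big (fun F => odflt s0 (F l)) [in L]) /=; last first.
    move=> F; rewrite unfold_in => /asboolP FT; case E : (F l) => [s|//] /=.
    by case: FT => _ /(_ _ _ E).
  apply: eq_bigr => s sL; rewrite -sum1_card; apply: eq_bigl => F; rewrite inE /= andbT.
  apply: andb_id2l; rewrite unfold_in => /asboolP FT.
  have := slot_tree_leaf_occupied FT lW Hl s0L (LW _ s0L).
  by case: (F l).
rewrite factS -cL -sum_nat_const; apply: eq_bigr => s sL.
rewrite (card_slot_tree_leaf lW Hl sL (LW _ sL))//.
have cL' : #|(L :\ s)%SET| = n by move: (cardsD1 s L); rewrite sL cL => -[].
rewrite -(IH (W :\ l)%SET (L :\ s)%SET cL').
- by apply: eq_card => F; rewrite !inE andbT.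
- exact: slots_in_detach.
- by move: (cardsD1 l W); rewrite lW cW cL' cL => -[].
Qed.

Definition holds (E : seq (V * S)) : pred {ffun V -> option S} :=
  fun F => all (fun e => F e.1 == Some e.2) E.

(** The edges can be removed from the front of the list on, each one being that
    of a leaf when its turn comes. *)
Fixpoint peelable W L (E : seq (V * S)) : bool :=
  if E is e :: E' then
    [&& e.1 \in W, [forall s in L, own s != e.1], e.2 \in L &
        peelable (W :\ e.1) (L :\ e.2) E']
  else true.

Lemma peelable_notin W L E l : l \notin W -> peelable W L E ->
  forall e, e \in E -> e.1 != l.
Proof.
elim: E W L => //= e E IH W L lW /and4P[eW _ _ pE] e'.
rewrite inE => /predU1P[->|]; first by apply: contraNneq lW => <-.
by apply: IH pE e'; rewrite !inE (negPf lW) andbF.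
Qed.

Lemma holds_set_slot F l o E : (forall e, e \in E -> e.1 != l) ->
  holds E (set_slot F l o) = holds E F.
Proof.
by move=> H; apply: eq_in_all => e /H el; rewrite ffunE (negPf el).
Qed.

(** Each peeled edge fixes one of the slots still available, so it removes one
    factor from the factorial. *)
Lemma card_slot_tree_holds W L E : (forall s, s \in L -> own s \in W) ->
  #|W| = #|L|.+1 -> peelable W L E ->
  (#|[pred F | slot_tree W L F && holds E F]| * #|L| ^_ (size E) = (#|L|)`!)%N.
Proof.
elim: E W L => [|e E IH] W L LW cW /=.
  by move=> _; rewrite muln1 -(card_slot_tree LW cW); apply: eq_card => F; rewrite !inE andbT.
move=> /and4P[eW /forall_inP Hl eL pE].
have cL := cardsD1 e.2 L; rewrite eL /= add1n in cL.
rewrite cL factS -(IH (W :\ e.1)%SET (L :\ e.2)%SET)//; last 2 first.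
- exact: slots_in_detach.
- by move: (cardsD1 e.1 W); rewrite eW cW cL => -[].
rewrite ffactSS mulnCA; congr (_ * (_ * _))%N.
rewrite -(@card_slot_tree_leaf W L e.1 e.2 (holds E)) ?LW//.
move=> F o; apply: holds_set_slot; apply: peelable_notin pE.
by rewrite !inE eqxx.
Qed.

End SlotTrees.

(** * Words of a depth-first exploration *)

Section Words.
Variables (V S : finType) (own : S -> V).
Implicit Types (F : {ffun V -> option S}) (st : seq S) (x y : seq V)
  (L : {set S}) (E : seq (V * S)).

Definition slots (v : V) : seq S := enum [pred s | own s == v].
Definition deg (v : V) : nat := size (slots v).

Lemma mem_slots s v : (s \in slots v) = (own s == v).
Proof. by rewrite mem_enum inE. Qed.

(** Depth-first exploration: [st] is the stack of slots still to be visited and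
    [x] lists the vertices met, so each new vertex occupies the top slot and
    pushes its own slots.  Working with words instead of labelled trees makes
    the labelled copies of a plane tree plain lists of vertices. *)
Fixpoint edges st x : seq (V * S) :=
  match st, x with
  | s :: st', v :: x' => (v, s) :: edges (slots v ++ st') x'
  | _, _ => [::]
  end.

(** The stack runs empty exactly when the word ends. *)
Fixpoint empties st x : bool :=
  match st, x with
  | [::], [::] => true
  | s :: st', v :: x' => empties (slots v ++ st') x'
  | _, _ => false
  end.

Definition tree_edges x := if x is v :: x' then edges (slots v) x' else [::].
Definition tree_word x := if x is v :: x' then empties (slots v) x' else false.

Lemma edges_fst st x : empties st x -> unzip1 (edges st x) = x.
Proof. by elim: x st => [|v x IH] [|s st] //= /IH ->. Qed.

Lemma edges_snd st x : empties st x ->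
  perm_eq (unzip2 (edges st x)) (st ++ flatten (map slots x)).
Proof.
elim: x st => [|v x IH] [|s st] //= /IH H; rewrite perm_cons.
by rewrite (perm_trans H)// -catA perm_catCA.
Qed.

(** Preorder degree sequences are prefix-free: the exploration of a forest stops
    by itself. *)
Lemma degrees_empties st x (ts : seq ptree) : size ts = size st ->
  map deg x = flatten (map ptree_degrees ts) -> empties st x.
Proof.
elim: x st ts => [|v x IH] [|s st] [|[us] ts] //= [sz] [dv dx].
apply: (IH _ (us ++ ts)); first by rewrite !size_cat sz -dv.
by rewrite map_cat flatten_cat.
Qed.

Lemma degrees_tree_word x t : map deg x = ptree_degrees t -> tree_word x.
Proof.
case: x t => [|v x] [us] //= [dv dx].
exact: degrees_empties dx.
Qed.

(** This makes the reversed list of edges peelable: a vertex is removed after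
    the occupants of its slots. *)
Definition later_slots (L : {set S}) (E : seq (V * S)) : Prop :=
  forall E1 e E2, E = E1 ++ e :: E2 ->
  forall s, s \in L -> own s = e.1 -> s \in unzip2 E2.

Lemma later_slots_cons L e E :
  (forall s, s \in L -> own s = e.1 -> s \in unzip2 E) ->
  later_slots L E -> later_slots L (e :: E).
Proof.
move=> H lE [|e1 E1] e2 E2 /= []; first by move=> <- <-.
by move=> _ /lE.
Qed.

Lemma later_slots_cat L E E' : later_slots L E -> later_slots L E' ->
  later_slots L (E ++ E').
Proof.
elim: E => //= e E IH lE lE'; apply: later_slots_cons.
  by move=> s sL /(lE [::] _ _ erefl s sL) sE; rewrite /unzip2 map_cat mem_cat sE.
apply: IH => // E1 e1 E2 EE; apply: (lE (e :: E1)); by rewrite EE.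
Qed.

Lemma edges_later_slots L st x : empties st x -> later_slots L (edges st x).
Proof.
elim: x st => [|v x IH] [|s st] //=; try by move=> _ [].
move=> H; apply: later_slots_cons; last exact: IH.
move=> s' _ /eqP s'v; rewrite (perm_mem (edges_snd H)) !mem_cat mem_slots.
by rewrite s'v.
Qed.

Lemma peelable_rev (W : {set V}) (L : {set S}) E :
  uniq (unzip1 E) -> {subset unzip1 E <= W} -> uniq (unzip2 E) ->
  {subset unzip2 E <= L} -> later_slots L E -> peelable own W L (rev E).
Proof.
elim/last_ind: E W L => [|E e IH] W L //.
rewrite rev_rcons /= /unzip1 /unzip2 !map_rcons !rcons_uniq.
move=> /andP[n1 u1] s1 /andP[n2 u2] s2 lE; apply/and4P; split.
- by apply: s1; rewrite mem_rcons mem_head.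
- apply/forall_inP => s sL; apply/negP => /eqP os.
  have := lE E e [::]; rewrite cats1 => /(_ erefl s sL os).
  by rewrite in_nil.
- by apply: s2; rewrite mem_rcons mem_head.
- apply: IH => //.
  + move=> v vE; rewrite !inE s1 ?mem_rcons ?inE ?vE ?orbT// andbT.
    by apply: contraNneq n1 => <-.
  + move=> v vE; rewrite !inE s2 ?mem_rcons ?inE ?vE ?orbT// andbT.
    by apply: contraNneq n2 => <-.
  + move=> E1 e1 E2 EE s; rewrite !inE => /andP[se sL] os.
    have := lE E1 e1 (rcons E2 e); rewrite EE rcons_cat => /(_ erefl s sL os).
    by rewrite /unzip2 map_rcons mem_rcons inE (negPf se).
Qed.

Lemma uniq_flatten_slots x : uniq x -> uniq (flatten (map slots x)).
Proof.
elim: x => //= v x IH /andP[vx /IH ux]; rewrite cat_uniq ux enum_uniq /= andbT.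
apply/hasPn => s /flatten_mapP[w wx]; rewrite !mem_slots => /eqP os.
by apply: contraNneq vx => <-; rewrite os.
Qed.

Lemma tree_edges_fst x : tree_word x -> unzip1 (tree_edges x) = behead x.
Proof. by case: x => //= v x /edges_fst. Qed.

Lemma tree_edges_snd x : tree_word x ->
  perm_eq (unzip2 (tree_edges x)) (flatten (map slots x)).
Proof. by case: x => //= v x /edges_snd. Qed.

Lemma size_tree_edges x : tree_word x -> size (tree_edges x) = (size x).-1.
Proof. by move=> /tree_edges_fst H; rewrite -size_behead -H size_map. Qed.

Lemma tree_edges_later L x : tree_word x -> later_slots L (tree_edges x).
Proof. by case: x => //= v x; exact: edges_later_slots. Qed.

(** In a depth-first exploration descendants come after their ancestors, so
    removing the last explored vertex first always removes a leaf. *)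
Lemma peelable_tree_words (xs : seq (seq V)) : all tree_word xs ->
  uniq (flatten xs) ->
  peelable own finset.setT finset.setT (rev (flatten (map tree_edges xs))).
Proof.
move=> /allP xsT ux; set E := flatten _.
have E1 : subseq (unzip1 E) (flatten xs).
  rewrite /E; elim: xs xsT {ux E} => //= x xs IH H.
  rewrite /unzip1 map_cat cat_subseq ?IH//; last first.
    by move=> y yxs; apply: H; rewrite inE yxs orbT.
  rewrite -/(unzip1 _) tree_edges_fst ?H ?mem_head//.
  by rewrite -drop1 drop_subseq.
have E2 : perm_eq (unzip2 E) (flatten (map slots (flatten xs))).
  rewrite /E; elim: xs xsT {ux E E1} => //= x xs IH H.
  rewrite /unzip2 !map_cat flatten_cat; apply: perm_cat.
    by apply: tree_edges_snd; rewrite H ?mem_head.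
  by apply: IH => y yxs; apply: H; rewrite inE yxs orbT.
apply: peelable_rev.
- exact: subseq_uniq E1 ux.
- by move=> v; rewrite inE.
- by rewrite (perm_uniq E2) uniq_flatten_slots.
- by move=> s; rewrite inE.
- rewrite /E; elim: xs xsT {ux E E1 E2} => //= [|x xs IH H]; first by move=> _ [].
  apply: later_slots_cat; first by apply: tree_edges_later; rewrite H ?mem_head.
  by apply: IH => y yxs; apply: H; rewrite inE yxs orbT.
Qed.

End Words.

(** * Words and fringe subtrees *)

Lemma all2_size (A B : Type) (r : A -> B -> bool) s t : all2 r s t -> size s = size t.
Proof. by elim: s t => [|a s IH] [|b t] //= /andP[_ /IH ->]. Qed.

Lemma all2_cat (A B : Type) (r : A -> B -> bool) s1 s2 t1 t2 :
  size s1 = size t1 ->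
  all2 r (s1 ++ s2) (t1 ++ t2) = all2 r s1 t1 && all2 r s2 t2.
Proof. by elim: s1 t1 => [|a s IH] [|b t] //= [/IH ->]; rewrite andbA. Qed.

Lemma uiso_size t1 t2 : uiso t1 t2 -> ptree_size t1 = ptree_size t2.
Proof. by move=> /uiso_degrees/perm_size. Qed.

Lemma ptree_size_node s :
  ptree_size (PNode s) = (\sum_(t <- s) ptree_size t).+1.
Proof.
rewrite /ptree_size /= size_flatten /shape -map_comp sumnE big_map.
by congr _.+1.
Qed.

Section Trees.
Variables (V S : finType) (own : S -> V).
Implicit Types (F : {ffun V -> option S}) (st : seq S) (x y ws : seq V).

Definition parent_fun F : {ffun V -> option V} := [ffun v => omap own (F v)].

Lemma mem_children (f : {ffun V -> option V}) u v :
  (u \in children f v) = (f u == Some v).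
Proof. by rewrite mem_filter mem_enum andbT. Qed.

Lemma parent_relE F u v : parent_rel own F u v = (u \in children (parent_fun F) v).
Proof. by rewrite mem_children ffunE. Qed.

(** When all vertices and slots are alive, a slot tree is an injective slot
    assignment above a rooted tree. *)
Lemma slot_treeT F : is_slot_tree own finset.setT finset.setT F <->
  (forall u v s, F u = Some s -> F v = Some s -> u = v) /\
  is_rooted_tree (parent_fun F).
Proof.
have E r v : connect (parent_rel own F) v r =
    connect [rel x y | parent_fun F x == Some y] v r.
  by apply: eq_connect => x y /=; rewrite ffunE.
split=> [[F1 F2 F3 [r [_ Fr rP]]]|[F3 /existsP[r /andP[Fr /forallP rP]]]].
  split => //; apply/existsP; exists r; rewrite ffunE Fr /=.
  by apply/forallP => v; rewrite -E rP// inE.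
split => //; try by move=> *; rewrite inE.
  by move=> v; rewrite inE.
exists r; rewrite inE; split => //; last by move=> v _; rewrite E rP.
by move: Fr; rewrite ffunE; case: (F r).
Qed.

Section OneTree.
Variable F : {ffun V -> option S}.
Hypothesis cVS : #|V| = #|S|.+1.
Hypothesis FT : is_slot_tree own finset.setT finset.setT F.

Let f := parent_fun F.
Let G v := unfold_tree (children f) #|V| v.

Lemma slot_inj u v s : F u = Some s -> F v = Some s -> u = v.
Proof. by case: FT => _ _ + _; apply. Qed.

Lemma parent_rooted : is_rooted_tree f.
Proof. by have [_] := (slot_treeT F).1 FT. Qed.

(** There is exactly one vertex more than there are slots, and only the root
    occupies no slot. *)
Lemma slot_occupied s : exists v, F v = Some s.
Proof.
case: FT => _ _ F3 [r [_ Fr rP]].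
have Fsome v : v != r -> F v != None.
  move=> vr; have /connectP[[|y q] /=] := rP v (finset.in_setT v).
    by move=> _ e; rewrite e eqxx in vr.
  by move=> /andP[/parent_relP[s' ->]].
have inj : {in (predC1 r) &, injective F}.
  move=> u v /Fsome; case E : (F u) => [s'|//] _ _ E'; exact: F3 E (esym E').
have : [seq F v | v in predC1 r] =i [seq Some s' | s' in S].
  apply/subset_cardP.
    rewrite (card_in_image inj) fintype.card_image; last by move=> a b [].
    by have := cardC (pred1 r); rewrite card1 cVS add1n => -[].
  apply/fintype.subsetP => _ /fintype.imageP[v /Fsome vr ->].
  by move: vr; case: (F v) => // s' _; apply/fintype.imageP; exists s'; rewrite ?inE.
move=> /(_ (Some s)); rewrite [RHS]fintype.image_f// => /fintype.imageP[v _ e].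
by exists v.
Qed.

Lemma slots_occupied st : exists ws, map F ws = map Some st.
Proof.
elim: st => [|s st [ws e]]; first by exists [::].
by have [v Fv] := slot_occupied s; exists (v :: ws); rewrite /= Fv e.
Qed.

Lemma occupants_children ws v : map F ws = map Some (slots own v) ->
  perm_eq ws (children f v).
Proof.
move=> e; apply: uniq_perm.
- apply: (@map_uniq _ _ F); rewrite e map_inj_uniq ?enum_uniq//.
- rewrite /children; apply: filter_uniq; exact: enum_uniq.
move=> w; rewrite mem_children ffunE; apply/idP/eqP.
  move=> /(map_f F); rewrite e => /mapP[s]; rewrite mem_slots => /eqP <- -> //.
case E : (F w) => [s|//] /= [os].
have : Some s \in map F ws.
  by rewrite e map_f// mem_slots os.
by move=> /mapP[w' w'ws /esym E']; rewrite (slot_inj E E').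
Qed.

Lemma size_children v : size (children f v) = deg own v.
Proof.
have [ws e] := slots_occupied (slots own v).
rewrite -(perm_size (occupants_children e)) /deg.
by rewrite -(size_map F) e size_map.
Qed.

Lemma unfoldE v : G v = PNode (map G (children f v)).
Proof. exact: unfold_children parent_rooted. Qed.

(** The size of the fringe subtree increases towards the root; it replaces the
    depth as a measure of acyclicity. *)
Lemma size_parent u v : parent_rel own F u v -> ptree_size (G u) < ptree_size (G v).
Proof.
rewrite parent_relE -/f => uv; rewrite (unfoldE v) ptree_size_node ltnS.
by rewrite big_map (big_rem _ uv) leq_addr.
Qed.

Lemma size_connect u v : connect (parent_rel own F) u v ->
  (u == v) || (ptree_size (G u) < ptree_size (G v)).
Proof.
move=> /connectP[q + ->]; elim: q u => [|w q IH] u /=; first by rewrite eqxx.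
move=> /andP[/size_parent uw /IH /orP[/eqP<-|wl]]; apply/orP; right => //.
exact: ltn_trans wl.
Qed.

Lemma connect_comparable u v w : connect (parent_rel own F) u v ->
  connect (parent_rel own F) u w ->
  connect (parent_rel own F) v w \/ connect (parent_rel own F) w v.
Proof.
move=> /connectP[q + ->]; elim: q u => [|a q IH] u /=; first by left.
move=> /andP[ua pq] /connectP[[|b q'] /=].
  move=> _ ->; right; apply/connectP; exists (a :: q) => //=; by rewrite ua.
move=> /andP[ub pq'] ew; subst w; apply: (IH a) => //.
have -> : a = b.
  by move: ua ub => /parent_relP[s Fu <-] /parent_relP[s']; rewrite Fu => -[<-] <-.
by apply/connectP; exists q'.
Qed.

(** The slots of [v] order its children in some way, the unfolding of the parent
    function in another; as unordered trees the results agree. *)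
Lemma uiso_parent us ws v : map F ws = map Some (slots own v) ->
  all2 uiso us (map G ws) -> uiso (PNode us) (G v).
Proof.
move=> e H; rewrite unfoldE; apply/uisoE; exists (map G ws) => //.
exact/perm_map/occupants_children.
Qed.

(** Starting from the occupants [ws] of the stacked slots, the exploration meets
    finitely many vertices, and orders their subtrees by the slots. *)
Lemma explore_exists st ws : map F ws = map Some st ->
  exists ts x, [/\ all2 uiso ts (map G ws),
    map (deg own) x = flatten (map ptree_degrees ts) & holds (edges own st x) F].
Proof.
have [n] := ubnP (\sum_(w <- ws) ptree_size (G w)).
elim: n st ws => // n IH [|s st] [|w ws] //.
  by move=> _ _; exists [::], [::].
rewrite big_cons ltnS /= => le [Fw e].
have [cs ecs] := slots_occupied (slots own w).
have [||ts [x [H1 H2 H3]]] := IH (slots own w ++ st) (cs ++ ws).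
- apply: leq_trans le; rewrite big_cat /= -addSn leq_add2r.
  rewrite unfoldE ptree_size_node ltnS big_map.
  by rewrite (perm_big _ (occupants_children ecs)).
- by rewrite !map_cat ecs e.
have sz : size cs = deg own w by rewrite -(size_map F) ecs size_map.
have szt : size (take (size cs) ts) = size cs.
  by rewrite size_takel// (all2_size H1) size_map size_cat leq_addr.
move: H1; rewrite -{1}(cat_take_drop (size cs) ts) map_cat all2_cat ?szt ?size_map//.
move=> /andP[a1 a2].
exists (PNode (take (size cs) ts) :: drop (size cs) ts), (w :: x); split => /=.
- by rewrite a2 andbT; apply: uiso_parent ecs a1.
- by rewrite szt sz H2 -{1}(cat_take_drop (size cs) ts) map_cat flatten_cat sz.
- by rewrite Fw eqxx.
Qed.

(** Conversely, a word that follows the edges of [F] determines the unordered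
    subtrees that it explores. *)
Lemma explore_uiso st ws ts x : map F ws = map Some st -> size ts = size st ->
  map (deg own) x = flatten (map ptree_degrees ts) -> holds (edges own st x) F ->
  all2 uiso ts (map G ws).
Proof.
elim: x st ws ts => [|v x IH] [|s st] [|w ws] [|[us] ts] //= [Fw e] [sz] [dv dx].
move=> /andP[/eqP Fv hx]; have vw := slot_inj Fv Fw; subst w.
have [cs ecs] := slots_occupied (slots own v).
have szc : size cs = deg own v by rewrite -(size_map F) ecs size_map.
have : all2 uiso (us ++ ts) (map G (cs ++ ws)).
  apply: IH hx; first by rewrite !map_cat ecs e.
    by rewrite !size_cat sz -dv.
  by rewrite map_cat flatten_cat.
rewrite map_cat all2_cat; last by rewrite size_map szc dv.
by move=> /andP[a1 a2]; apply/andP; split => //; exact: uiso_parent ecs a1.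
Qed.

(** Each next vertex is forced, being the only occupant of the top slot. *)
Lemma explore_inj st x y : empties own st x -> empties own st y ->
  holds (edges own st x) F -> holds (edges own st y) F -> x = y.
Proof.
elim: x y st => [|v x IH] [|w y] [|s st] //= ex ey.
move=> /andP[/eqP Fv hx] /andP[/eqP Fw hy].
have vw := slot_inj Fv Fw; subst w; congr cons; exact: IH ex ey hx hy.
Qed.

Lemma tree_word_inj x y : tree_word own x -> tree_word own y ->
  holds (tree_edges own x) F -> holds (tree_edges own y) F ->
  ohead x = ohead y -> x = y.
Proof.
case: x y => [|v x] [|w y] //= ex ey hx hy [vw]; subst w.
by congr cons; exact: explore_inj ex ey hx hy.
Qed.

Lemma explore_connect st x u : empties own st x -> holds (edges own st x) F ->
  u \in x -> exists2 s, s \in st & exists2 w, parent_rel own F w (own s) &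
    connect (parent_rel own F) u w.
Proof.
elim: x st => [|v x IH] [|s st] //= ex /andP[/eqP Fv hx].
have pv : parent_rel own F v (own s) by apply/parent_relP; exists s.
rewrite inE => /predU1P[->|ux].
  by exists s; rewrite ?mem_head//; exists v => //; exact: connect0.
have [s' + [w pw cw]] := IH _ ex hx ux.
rewrite mem_cat mem_slots => /orP[/eqP es|s'st].
  exists s; rewrite ?mem_head//; exists v => //.
  by apply: connect_trans cw _; apply: connect1; rewrite -es.
exists s'; first by rewrite inE s'st orbT.
by exists w.
Qed.

Lemma tree_word_connect x u v0 : tree_word own x -> holds (tree_edges own x) F ->
  u \in x -> connect (parent_rel own F) u (head v0 x).
Proof.
case: x => [|v x] //= ex hx; rewrite inE => /predU1P[->|ux]; first exact: connect0.
have [s + [w pw cw]] := explore_connect ex hx ux.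
rewrite mem_slots => /eqP <-; exact: connect_trans cw (connect1 pw).
Qed.

Lemma tree_word_uiso v x t : map (deg own) (v :: x) = ptree_degrees t ->
  holds (tree_edges own (v :: x)) F -> uiso t (G v).
Proof.
case: t => us [dv dx] /= hx.
have [cs ecs] := slots_occupied (slots own v).
by apply: (uiso_parent ecs); apply: explore_uiso hx.
Qed.

Lemma tree_word_exists v : exists t x, [/\ uiso t (G v),
  map (deg own) (v :: x) = ptree_degrees t & holds (tree_edges own (v :: x)) F].
Proof.
have [cs ecs] := slots_occupied (slots own v).
have [ts [x [H1 H2 H3]]] := explore_exists ecs.
exists (PNode ts), x; split => //=; first exact: uiso_parent H1.
rewrite H2; congr cons; rewrite (all2_size H1) size_map.
by rewrite -(size_map F) ecs size_map.
Qed.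

(** Each vertex below the head is listed once: the number of times it occurs
    equals the number of times its slot is visited, hence the number of times
    its parent occurs. *)
Lemma tree_word_uniq x : tree_word own x -> holds (tree_edges own x) F -> uniq x.
Proof.
case: x => [|v x] //= ex hx.
have vx : v \notin x.
  apply/negP => /(explore_connect ex hx)[s]; rewrite mem_slots => /eqP os [w].
  rewrite os => /size_parent lt /size_connect /orP[/eqP vw|lt'].
    by rewrite vw ltnn in lt.
  by have := ltn_trans lt lt'; rewrite ltnn.
rewrite vx /=; apply: count_mem_uniq => u.
have cE w s : F w = Some s ->
    count_mem w x = (count_mem s (slots own v) + count_mem (own s) x)%N.
  move=> Fw; rewrite -{1}(edges_fst ex) count_map.
  transitivity (count_mem s (unzip2 (edges own (slots own v) x))).
    rewrite count_map; apply: eq_in_count => e /(allP hx)/eqP Fe /=.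
    apply/eqP/eqP => [ew|es]; first by move: Fe; rewrite ew Fw => -[].
    by apply: slot_inj Fe _; rewrite Fw es.
  have /permP -> := edges_snd ex; rewrite count_cat; congr addn.
  elim: (x) => //= w' y IH; rewrite count_cat IH; congr addn.
  rewrite count_uniq_mem ?enum_uniq// mem_slots eq_sym; by [].
have c1 : count_mem u x <= 1.
  have [r [_ Fr rP]] : exists r, [/\ r \in [set: V]%SET, F r = None &
     forall v, v \in [set: V]%SET -> connect (parent_rel own F) v r] by case: FT.
  have xP w : F w = None -> count_mem w x = 0%N.
    move=> Fw; apply/count_memPn; rewrite -(edges_fst ex).
    apply/mapP => -[e /(allP hx)/eqP + we]; by rewrite -we Fw.
  have /connectP[q pq rq] := rP u (finset.in_setT u).
  elim: q u pq rq => [|w q IH] u /= => [_ ur|/andP[/parent_relP[s Fu os] pq] rq].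
    by rewrite xP// -ur.
  rewrite (cE _ _ Fu) count_uniq_mem ?enum_uniq// mem_slots os.
  case: eqP => [->|_]; first by rewrite (count_memPn _).
  exact: IH pq rq.
by case: (boolP (u \in x)) c1 => [|/count_memPn->//]; rewrite -has_pred1 has_count; case: count => [|[]].
Qed.

(** The ancestors of [u] form a chain along which the sizes of the fringe
    subtrees increase strictly, so at most one of them has the given size. *)
Lemma tree_word_meet x y u v0 : tree_word own x -> tree_word own y ->
  holds (tree_edges own x) F -> holds (tree_edges own y) F ->
  ptree_size (G (head v0 x)) = ptree_size (G (head v0 y)) ->
  u \in x -> u \in y -> x = y.
Proof.
move=> tx ty hx hy sz ux uy.
have cx := tree_word_connect v0 tx hx ux; have cy := tree_word_connect v0 ty hy uy.
have hE : head v0 x = head v0 y.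
  case: (connect_comparable cx cy) => /size_connect; rewrite sz ltnn orbF => /eqP //.
apply: tree_word_inj => //; move: tx ty hE; by case: (x) (y) => [|a x'] [|b y'] //= _ _ ->.
Qed.

End OneTree.
End Trees.

(** * First and second moments *)

Section Moments.
Variables (V S : finType) (own : S -> V).
Hypothesis cVS : #|V| = #|S|.+1.
Implicit Types (F : {ffun V -> option S}) (f : {ffun V -> option V}).

Definition full_slot_tree : pred {ffun V -> option S} :=
  slot_tree own finset.setT finset.setT.

(** The labelled trees, with the degrees expressed through the slots. *)
Definition degree_tree f : bool :=
  is_rooted_tree f && [forall v, size (children f v) == deg own v].

Definition slot_perm : pred {ffun S -> S} :=
  fun s => injectiveb s && [forall i, own (s i) == own i].

Lemma card_slot_perm_gt0 : 0 < #|slot_perm|.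
Proof.
apply/card_gt0P; exists [ffun i => i]; apply/andP; split.
  by apply/injectiveP => i j; rewrite !ffunE.
by apply/forallP => i; rewrite ffunE.
Qed.

Lemma parent_degree_tree F : full_slot_tree F -> degree_tree (parent_fun own F).
Proof.
move=> /asboolP FT; rewrite /degree_tree (parent_rooted FT) /=.
by apply/forallP => v; rewrite (size_children cVS FT).
Qed.

(** The children of a vertex take its slots in the order in which they are
    listed. *)
Lemma exists_slot_tree f : degree_tree f ->
  exists2 F, full_slot_tree F & parent_fun own F = f.
Proof.
move=> /andP[fT /forallP fd].
pose at_slot w v := if slots own v is s0 :: _
  then Some (nth s0 (slots own v) (index w (children f v))) else None.
pose F : {ffun V -> option S} := [ffun w => obind (at_slot w) (f w)].
have FE w v : f w = Some v -> exists2 s0, F w =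
    Some (nth s0 (slots own v) (index w (children f v))) &
    index w (children f v) < size (slots own v).
  move=> fw; have lt : index w (children f v) < size (slots own v).
    by rewrite -/(deg own v) -(eqP (fd v)) index_mem mem_children fw.
  rewrite ffunE fw /= /at_slot; case E : (slots own v) lt => [|s0 l] // lt.
  by exists s0.
have Fown w v : f w = Some v -> exists2 s, F w = Some s & own s = v.
  move=> fw; have [s0 -> lt] := FE _ _ fw; eexists; first reflexivity.
  by apply/eqP; rewrite -mem_slots mem_nth.
have pF : parent_fun own F = f.
  apply/ffunP => w; rewrite ffunE; case E : (f w) => [v|].
    by have [s -> /= ->] := Fown _ _ E.
  by rewrite ffunE E.
exists F => //; apply/asboolP/slot_treeT; split; last by rewrite pF.
move=> u w s Fu Fw.
have [v fu] : exists v, f u = Some v.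
  by move: Fu; rewrite ffunE; case: (f u) => // v _; exists v.
have [v' fw] : exists v, f w = Some v.
  by move: Fw; rewrite ffunE; case: (f w) => // v' _; exists v'.
have vv : v = v'.
  by have [s1] := Fown _ _ fu; have [s2] := Fown _ _ fw; rewrite Fu Fw => -[<-] <- [<-].
subst v'; have [s1] := FE _ _ fu; rewrite Fu => -[es1] lt1.
have [s2] := FE _ _ fw; rewrite Fw => -[es2] lt2.
have : index u (children f v) == index w (children f v).
  rewrite -(nth_uniq s1 lt1 lt2) ?enum_uniq//.
  by rewrite -es1 es2; apply/eqP/set_nth_default.
move=> /eqP/(congr1 (nth u (children f v))).
by rewrite !nth_index// mem_children ?fu ?fw.
Qed.

(** Permuting the slots of each vertex acts freely and transitively on the slot
    trees with a given parent function. *)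
Lemma card_slot_tree_over f : degree_tree f ->
  #|[pred F | full_slot_tree F && (parent_fun own F == f)]| = #|slot_perm|.
Proof.
move=> /exists_slot_tree[F0 F0T F0f].
have /asboolP F0P := F0T; have [F0inj F0root] := (slot_treeT own F0).1 F0P.
pose act (s : {ffun S -> S}) : {ffun V -> option S} := [ffun v => omap s (F0 v)].
have act_inj : injective act.
  move=> s s' /ffunP e; apply/ffunP => i; have [v Fv] := slot_occupied cVS F0P i.
  by have := e v; rewrite !ffunE Fv /= => -[].
rewrite -(fintype.card_image act_inj); apply: eq_card => F.
rewrite inE; apply/idP/fintype.imageP.
  move=> /andP[/asboolP FT /eqP Ff].
  have [Finj Froot] := (slot_treeT own F).1 FT.
  have pick_s i : exists s, exists2 v, F0 v = Some i & F v = Some s /\ own s = own i.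
    have [v F0v] := slot_occupied cVS F0P i.
    have : parent_fun own F v = parent_fun own F0 v by rewrite Ff F0f.
    rewrite !ffunE F0v /=; case E : (F v) => [s|//] /= [os].
    by exists s, v.
  have [g gP] := boolp.choice pick_s.
  have ginj : injective g.
    move=> i j e; have [v Fi [Fv _]] := gP i; have [w Fj [Fw _]] := gP j.
    rewrite e in Fv; have vw := Finj _ _ _ Fv Fw; subst w.
    by move: Fi; rewrite Fj => -[].
  exists [ffun i => g i].
    apply/andP; split; first by apply/injectiveP => i j; rewrite !ffunE => /ginj.
    by apply/forallP => i; rewrite ffunE; have [_ _ [_ ->]] := gP i.
  apply/ffunP => v; rewrite ffunE; case E : (F0 v) => [i|] /=.
    rewrite ffunE; have [w F0w [Fw _]] := gP i.
    by rewrite (F0inj _ _ _ E F0w).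
  have : parent_fun own F v = parent_fun own F0 v by rewrite Ff F0f.
  by rewrite !ffunE E; case: (F v).
move=> [s /andP[/injectiveP sI sP] ->].
have af : parent_fun own (act s) = f.
  rewrite -F0f; apply/ffunP => v; rewrite !ffunE; case: (F0 v) => //= i.
  by move/forallP: sP => /(_ i)/eqP ->.
rewrite af eqxx andbT; apply/asboolP/slot_treeT; split; last by rewrite af -F0f.
move=> u v i; rewrite !ffunE; case Eu : (F0 u) => [j|//] /=.
case Ev : (F0 v) => [k|//] /= [<-] [] /sI kj.
by apply: F0inj Eu _; rewrite Ev kj.
Qed.

Lemma sum_slot_tree (h : {ffun V -> option V} -> nat) :
  (\sum_(F | full_slot_tree F) h (parent_fun own F) =
   (\sum_(f | degree_tree f) h f) * #|slot_perm|)%N.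
Proof.
rewrite (partition_big (parent_fun own) degree_tree); last exact: parent_degree_tree.
rewrite big_distrl /=; apply: eq_bigr => f fT.
rewrite (eq_bigr (fun=> h f)); last by move=> F /andP[_ /eqP ->].
by rewrite sum_nat_const mulnC -(card_slot_tree_over fT).
Qed.

Lemma card_full_slot_tree : ((#|S|)`! = #|degree_tree| * #|slot_perm|)%N.
Proof.
have := sum_slot_tree (fun=> 1%N); rewrite !sum1_card => <-.
rewrite card_slot_tree ?cardsT//; by move=> s _; rewrite inE.
Qed.

Definition degree_words (T : utree) : seq (seq nat) :=
  map ptree_degrees (finmap.enum_fset (fset_set (Ord T))).

Lemma mem_degree_words (T : utree) l :
  reflect (exists2 t, forget_order t = T & l = ptree_degrees t)
    (l \in degree_words T).
Proof.
apply: (iffP mapP) => -[t tT ->]; exists t => //.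
  by move: tT; rewrite in_fset_set ?inE//; exact: finite_Ord.
by rewrite in_fset_set ?inE//; exact: finite_Ord.
Qed.

Lemma size_degree_words T l : l \in degree_words T -> size l = utree_size T.
Proof. by move=> /mem_degree_words[t /Ord_degrees/perm_size + ->]. Qed.

Lemma utree_size_gt0 T : 0 < utree_size T.
Proof. by rewrite /utree_size; case: (repr T). Qed.

Definition word_of (T : utree) (x : (utree_size T).-tuple V) : bool :=
  map (deg own) x \in degree_words T.

Lemma word_of_tree T (x : (utree_size T).-tuple V) : word_of x -> tree_word own x.
Proof. by move=> /mem_degree_words[t _ /degrees_tree_word]. Qed.

Let fringe_tree F v :=
  unfold_tree (children (parent_fun own F)) #|V| v.

Lemma word_of_uiso T F (x : (utree_size T).-tuple V) v0 : full_slot_tree F ->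
  word_of x -> holds (tree_edges own x) F ->
  uiso (repr T) (fringe_tree F (head v0 x)).
Proof.
move=> /asboolP FT /mem_degree_words[t tT xt] hx.
apply: (@uiso_trans t).
  by apply/forget_order_eq; rewrite tT /forget_order reprK.
case: x xt hx => -[|v x] /= _ xt hx; first by case: (t) xt.
exact: (tree_word_uiso cVS FT xt hx).
Qed.

Lemma word_of_size T F (x : (utree_size T).-tuple V) v0 : full_slot_tree F ->
  word_of x -> holds (tree_edges own x) F ->
  ptree_size (fringe_tree F (head v0 x)) = utree_size T.
Proof. by move=> FT xT hx; rewrite -(uiso_size (word_of_uiso v0 FT xT hx)). Qed.

(** The exploration from a vertex with fringe subtree [T] yields a word, and it
    is the only one with this head because each step is forced. *)
Lemma fringe_count_words T F : full_slot_tree F ->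
  fringe_count T (parent_fun own F) =
  #|[pred x : (utree_size T).-tuple V | word_of x && holds (tree_edges own x) F]|.
Proof.
move=> FT; have /asboolP FP := FT; rewrite /fringe_count.
have /card_gt0P[v0 _] : 0 < #|V| by rewrite cVS.
pose hd (x : (utree_size T).-tuple V) := head v0 x.
have inj : {in [pred x : (utree_size T).-tuple V |
    word_of x && holds (tree_edges own x) F] &, injective hd}.
  move=> x y; rewrite !inE => /andP[xT hx] /andP[yT hy] e; apply/val_inj => /=.
  apply: (tree_word_inj FP (word_of_tree xT) (word_of_tree yT) hx hy).
  move: e (word_of_tree xT) (word_of_tree yT); rewrite /hd.
  by case: (tval x) (tval y) => [|a x'] [|b y'] //= ->.
rewrite -(card_in_image inj); apply: eq_card => v; rewrite inE.
apply/eqP/fintype.imageP.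
  move=> vT; have [t [x [tG xt hx]]] := tree_word_exists cVS FP v.
  have tT : forget_order t = T by rewrite -vT; apply/forget_order_eq.
  have xT : map (deg own) (v :: x) \in degree_words T.
    by apply/mem_degree_words; exists t.
  have sz : size (v :: x) == utree_size T.
    by rewrite -(size_degree_words xT) size_map.
  by exists (Tuple sz); rewrite // inE /word_of xT.
move=> [x]; rewrite inE => /andP[xT hx] ->.
have := word_of_uiso v0 FT xT hx; rewrite uiso_sym => /forget_order_eq.
by rewrite /forget_order reprK.
Qed.

Definition uniq_words (T : utree) : pred ((utree_size T).-tuple V) :=
  fun x => word_of x && uniq x.

(** All words of the given sizes are equally likely. *)
Lemma card_holds_words (xs : seq (seq V)) : all (tree_word own) xs ->
  uniq (flatten xs) ->
  (#|[pred F | full_slot_tree F && all (fun x => holds (tree_edges own x) F) xs]| *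
   #|S| ^_ (size (flatten (map (tree_edges own) xs))) =
   #|degree_tree| * #|slot_perm|)%N.
Proof.
move=> xsT ux; rewrite -card_full_slot_tree.
have SV s : s \in [set: S]%SET -> own s \in [set: V]%SET by rewrite !inE.
have := @card_slot_tree_holds V S own finset.setT finset.setT _ SV _
  (peelable_tree_words xsT ux).
rewrite !cardsT size_rev => /(_ cVS) <-; congr (_ * _)%N; apply: eq_card => F.
rewrite !inE; congr andb; rewrite /holds all_rev; elim: (xs) => //= x xs' ->.
by rewrite all_cat.
Qed.

(** Words with a repetition never occur; the others occur with equal
    probability. *)
Lemma sum_fringe_count T :
  ((\sum_(f | degree_tree f) fringe_count T f) * #|S| ^_ (utree_size T).-1 =
   #|degree_tree| * #|@uniq_words T|)%N.
Proof.
apply/eqP; rewrite -(eqn_pmul2r card_slot_perm_gt0); apply/eqP.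
rewrite mulnAC -sum_slot_tree.
rewrite (eq_bigr _ (fun F FT => fringe_count_words T FT)).
under eq_bigr do rewrite -sum1_card big_mkcond /=.
rewrite exchange_big /= big_distrl /= (bigID (@uniq_words T)) /= addnC big1 ?add0n.
  rewrite mulnAC -mulnC -sum_nat_const; apply: eq_bigr => x /andP[xT ux].
  have := @card_holds_words [:: val x]; rewrite /= cats0 andbT cats0.
  move=> /(_ (word_of_tree xT) ux); rewrite size_tree_edges ?word_of_tree//.
  rewrite size_tuple => <-; congr (_ * _)%N.
  rewrite -sum1_card -big_mkcondr; apply: eq_bigl => F.
  by rewrite !inE xT andbT.
move=> x; rewrite /uniq_words negb_and => nx; rewrite big1 ?mul0n// => F /asboolP FT.
rewrite inE; case: (boolP (word_of x)) nx => //= xT nx.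
case: ifP => // /(tree_word_uniq FT (word_of_tree xT)) ux.
by rewrite ux in nx.
Qed.

(** The square counts pairs of words.  Overlapping pairs are equal, and are
    counted by the first moment; disjoint pairs are bounded by all pairs of
    repetition-free words. *)
Lemma sum_fringe_count2 T :
  ((\sum_(f | degree_tree f) fringe_count T f ^ 2) *
     #|S| ^_ ((utree_size T).-1 + (utree_size T).-1) <=
   #|degree_tree| * #|@uniq_words T| ^ 2 +
   (\sum_(f | degree_tree f) fringe_count T f) *
     #|S| ^_ ((utree_size T).-1 + (utree_size T).-1))%N.
Proof.
set k := #|S| ^_ _.
rewrite -(leq_pmul2r card_slot_perm_gt0) mulnDl.
rewrite mulnAC -(sum_slot_tree (fun f => fringe_count T f ^ 2)%N).
rewrite [X in (_ <= _ + X)%N]mulnAC -sum_slot_tree -mulnAC.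
pose hw (x : (utree_size T).-tuple V) F := word_of x && holds (tree_edges own x) F.
have cE F : full_slot_tree F -> fringe_count T (parent_fun own F) = (\sum_x hw x F)%N.
  move=> FT; rewrite fringe_count_words// -sum1_card big_mkcond /=.
  by apply: eq_bigr => x _; rewrite inE /hw; case: ifP.
pose disj (x y : (utree_size T).-tuple V) := uniq (val x ++ val y).
have le F : full_slot_tree F -> (fringe_count T (parent_fun own F) ^ 2 <=
    \sum_x \sum_(y | disj x y) (hw x F && hw y F) +
    fringe_count T (parent_fun own F))%N.
  move=> FT; rewrite cE// expnS expn1 big_distrl -big_split leq_sum//= => x _.
  rewrite big_distrr /= (bigID (disj x)) /= leq_add//.
    by apply: leq_sum => y _; case: (hw x F); case: (hw y F).
  have [hx|//] := boolP (hw x F); last by rewrite big1// => y _; rewrite mul0n.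
  have /asboolP FP := FT; have /andP[xT xh] := hx.
  rewrite (bigD1 x) /=; last first.
    apply/negP; rewrite /disj cat_uniq => /and3P[_ /hasPn h _].
    have sx : 0 < size (val x) by rewrite size_tuple utree_size_gt0.
    case: (val x) sx h => // v x' _ /(_ v (mem_head v x'))/negP[].
    exact: mem_head.
  rewrite big1 ?addn0 ?mul1n ?leq_b1//= => y /andP[xy yx].
  case: (boolP (hw y F)) => // /andP[yT yh]; case/eqP: yx; apply/val_inj => /=.
  have ux := tree_word_uniq FP (word_of_tree xT) xh.
  have uy := tree_word_uniq FP (word_of_tree yT) yh.
  move: xy; rewrite /disj cat_uniq ux uy /= andbT negbK => /hasP[u uy' ux'].
  have /card_gt0P[v0 _] : 0 < #|V| by rewrite cVS.
  apply: (tree_word_meet (v0 := v0) FP (word_of_tree yT) (word_of_tree xT) yh xh _ uy' ux').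
  by rewrite (word_of_size v0 FT xT xh) (word_of_size v0 FT yT yh).
apply: (@leq_trans ((\sum_(F | full_slot_tree F)
    (\sum_x \sum_(y | disj x y) (hw x F && hw y F) +
    fringe_count T (parent_fun own F))) * k)%N).
  by rewrite leq_mul2r leq_sum ?orbT.
rewrite big_split mulnDl /= -/k leq_add2r.
rewrite exchange_big big_distrl /=.
apply: (@leq_trans (\sum_(x : (utree_size T).-tuple V) \sum_(y : (utree_size T).-tuple V)
    (uniq_words x && uniq_words y) * (#|degree_tree| * #|slot_perm|))%N); last first.
  rewrite (bigID (fun x => @uniq_words T x)) /= [X in (_ + X)%N]big1 ?addn0; last first.
    by move=> x nx; rewrite big1// => y _; rewrite (negPf nx).
  rewrite (eq_bigr (fun=> #|@uniq_words T| * (#|degree_tree| * #|slot_perm|))%N).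
    by rewrite sum_nat_const mulnA mulnC.
  move=> x ->; rewrite -[RHS](sum_nat_const (@uniq_words T)) [RHS]big_mkcond /=.
  by apply: eq_bigr => y _; rewrite -[y \in _]/(uniq_words y); case: (uniq_words y); rewrite ?mul1n.
apply: leq_sum => x _; rewrite exchange_big big_distrl /= big_mkcond leq_sum//= => y _.
case: ifP => // dxy; have ux := dxy; move: (dxy); rewrite /disj cat_uniq => /and3P[uqx _ uqy].
rewrite /uniq_words uqx uqy !andbT.
have [xT|] := boolP (word_of x); last first.
  by move=> nx; rewrite big1// => F _; rewrite /hw (negPf nx).
have [yT|] := boolP (word_of y); last first.
  by move=> ny; rewrite big1// => F _; rewrite /hw (negPf ny) andbF.
rewrite mul1n; have := @card_holds_words [:: val x; val y].
rewrite /= !cats0 andbT size_cat !size_tree_edges ?word_of_tree// !size_tuple.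
move=> /(_ isT ux) <-; rewrite leq_mul2r; apply/orP; right.
rewrite -sum1_card [leqRHS]big_mkcondr /=; apply: eq_leq.
by apply: eq_bigr => F _; rewrite /hw xT yT andbT; case: (_ && _).
Qed.

End Moments.

(** * Counting words with prescribed degrees *)

Lemma forest_degrees_inj ts us : size ts = size us ->
  flatten (map ptree_degrees ts) = flatten (map ptree_degrees us) -> ts = us.
Proof.
have [n] := ubnP (size (flatten (map ptree_degrees ts))).
elim: n ts us => // n IH [|[ts1] ts] [|[us1] us] //= lt [sz] [sz1 e].
have : ts1 ++ ts = us1 ++ us.
  apply: IH; rewrite ?map_cat ?flatten_cat//; last by rewrite !size_cat sz sz1.
by move=> /eqP; rewrite eqseq_cat// => /andP[/eqP -> /eqP ->].
Qed.

Lemma ptree_degrees_inj : injective ptree_degrees.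
Proof.
move=> t u e; have : [:: t] = [:: u] by apply: forest_degrees_inj; rewrite //= e.
by case.
Qed.

Lemma degree_lt_size t i : i \in ptree_degrees t -> (i < ptree_size t)%N.
Proof.
elim/ptree_ind_mem: t => s IH; rewrite ptree_size_node ltnS inE.
move=> /predU1P[->|/flattenP[_ /mapP[t ts ->] /(IH _ ts) lt]].
  rewrite -sum1_size; elim: s {IH} => [|t s IHs]; first by rewrite big_nil.
  by rewrite !big_cons leq_add//; case: t.
by rewrite (big_rem _ ts) /= (leq_trans (ltnW lt)) ?leq_addr.
Qed.

Lemma degree_words_uniq T : uniq (degree_words T).
Proof. by rewrite map_inj_uniq ?finmap.fset_uniq//; exact: ptree_degrees_inj. Qed.

Section WordCount.
Variables (V : finType) (g : V -> nat).

Definition word_count m (l : seq nat) : nat :=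
  #|[pred x : m.-tuple V | uniq x && (map g x == l)]|.

Lemma word_count0 : word_count 0 [::] = 1%N.
Proof.
transitivity #|{: 0.-tuple V}|; last by rewrite card_tuple.
by apply: eq_card => x; rewrite tuple0 !inE.
Qed.

(** The first vertex ranges over those of degree [i] outside the rest of the
    word.  Forbidding [m] vertices is negligible, whence the two bounds that
    follow. *)
Lemma word_count_cons m i l :
  word_count m.+1 (i :: l) =
  (\sum_(x : m.-tuple V | uniq x && (map g x == l))
     #|[pred v | (g v == i) && (v \notin x)]|)%N.
Proof.
rewrite /word_count -sum1_card.
rewrite (partition_big (fun x : m.+1.-tuple V => [tuple of behead x])
  (fun x : m.-tuple V => uniq x && (map g x == l))) /=; last first.
  move=> x; case/tupleP: x => v x; rewrite !inE /= eqseq_cons.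
  by move=> /andP[/andP[_ ->] /andP[_ ->]].
apply: eq_bigr => x /andP[ux gx].
have inj : {in [pred v | (g v == i) && (v \notin x)] &, injective (fun v => [tuple of v :: x])}.
  by move=> v w _ _ /(congr1 val) /= [].
rewrite -(card_in_image inj) -sum1_card; apply: eq_bigl => y; rewrite inE.
apply/idP/fintype.imageP; last first.
  move=> [v]; rewrite inE => /andP[/eqP gv vx] ->; rewrite /= vx ux gv.
  rewrite eqseq_cons eqxx gx /=; by apply/eqP/val_inj.
case/tupleP: y => v y; rewrite /= eqseq_cons => /andP[/andP[/andP[vy uy] /andP[gv gy]] /eqP e].
have yx : val x = val y by rewrite -e.
exists v; last by apply/val_inj; rewrite /= yx.
by rewrite inE gv /= (_ : (v \in x) = (v \in val x))// yx.
Qed.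

Lemma word_count_le m i l :
  (word_count m.+1 (i :: l) <= #|[pred v | g v == i]| * word_count m l)%N.
Proof.
rewrite word_count_cons mulnC -sum_nat_const; apply: leq_sum => x _.
by apply: subset_leq_card; apply/fintype.subsetP => v; rewrite !inE => /andP[].
Qed.

Lemma word_count_ge m i l :
  (#|[pred v | g v == i]| * word_count m l <=
   word_count m.+1 (i :: l) + m * word_count m l)%N.
Proof.
rewrite word_count_cons ![(_ * word_count _ _)%N]mulnC -!sum_nat_const.
rewrite -big_split; apply: leq_sum => x _.
rewrite -(cardID [pred v | v \notin x] [pred v | g v == i]) leq_add//.
apply: (@leq_trans #|x|); last by rewrite -{2}(size_tuple x) card_size.
by apply: subset_leq_card; apply/fintype.subsetP => v; rewrite !inE negbK => /andP[].
Qed.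

End WordCount.

Lemma card_uniq_words (V S : finType) (own : S -> V) (T : utree) :
  #|@uniq_words V S own T| =
  (\sum_(l <- degree_words T) word_count (deg own) (utree_size T) l)%N.
Proof.
rewrite -sum1_card big_mkcond /=.
under [RHS]eq_bigr do rewrite /word_count -sum1_card big_mkcond /=.
rewrite exchange_big /=; apply: eq_bigr => x _.
rewrite -[x \in _]/(uniq_words own x) /uniq_words /word_of.
rewrite [RHS](eq_bigr (fun l => nat_of_bool (uniq x && (map (deg own) x == l)))).
  case: (uniq x) => /=; last by rewrite andbF big1_eq.
  rewrite andbT; transitivity (nat_of_bool (map (deg own) x \in degree_words T)).
    by case: (_ \in _).
  rewrite -count_uniq_mem ?degree_words_uniq// -sum1_count big_mkcond /=.
  by apply: eq_bigr => l _; rewrite eq_sym; case: eqP.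
by move=> l _; rewrite inE; case: (_ && _).
Qed.

(** * Limits of word counts *)

Local Open Scope classical_set_scope.
Local Open Scope ring_scope.

Section Limits.
Variable R : realType.

Lemma cvg_inv_size (n : nat -> nat) : n k @[k --> \oo] --> \oo ->
  (n k)%:R^-1 @[k --> \oo] --> (0 : R).
Proof.
move=> noo; have H : (fun m : nat => m%:R^-1 : R) @ \oo --> (0 : R).
  by rewrite -cvg_shiftS; exact: cvg_harmonic.
exact: (cvg_comp n (fun m : nat => m%:R^-1 : R) noo H).
Qed.

Lemma cvg_sum_seq (I : Type) (r : seq I) (u : I -> nat -> R) (l : I -> R) :
  (forall i, u i k @[k --> \oo] --> l i) ->
  (\sum_(i <- r) u i k) @[k --> \oo] --> \sum_(i <- r) l i.
Proof.
move=> ul; elim: r => [|i r IH].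
  by under eq_fun do rewrite big_nil; rewrite big_nil; exact: cvg_cst.
by under eq_fun do rewrite big_cons; rewrite big_cons; exact: cvgD (ul i) IH.
Qed.

Variable n : nat -> nat.
Hypothesis noo : n k @[k --> \oo] --> \oo.

Let n_gt0 : \forall k \near \oo, (0 < n k)%N.
Proof. by have /cvgnyPge/(_ 1%N) := noo. Qed.

(** Sampling with and without replacement agree in the limit. *)
Lemma cvg_ffact_ratio m : ((n k) ^_ m)%:R / (n k)%:R ^+ m @[k --> \oo] --> (1 : R).
Proof.
elim: m => [|m IH].
  by under eq_fun do rewrite ffactn0 expr0 divr1; exact: cvg_cst.
have L : 1 - m%:R * (n k)%:R^-1 @[k --> \oo] --> (1 : R).
  rewrite -[X in _ --> X]subr0; apply: cvgB; first exact: cvg_cst.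
  rewrite -(mulr0 m%:R); apply: cvgM; [exact: cvg_cst|exact: cvg_inv_size].
rewrite -[X in _ --> X]mulr1; apply: cvg_trans (cvgM IH L).
apply: near_eq_cvg; have /cvgnyPge/(_ m) nm := noo.
near=> k; have kn : (0 < n k)%N by near: k.
have km : (m <= n k)%N by near: k.
rewrite ffactnSr natrM natrB// exprSr /=.
have nn : (n k)%:R != 0 :> R by rewrite pnatr_eq0 -lt0n.
move: (expf_neq0 m nn); move: ((n k)%:R ^+ m) => a ann.
by field; rewrite nn ann.
Unshelve. all: by end_near. Qed.

Variables (V : nat -> finType) (g : forall k, V k -> nat) (p : nat -> R).
Hypothesis stat : forall i : nat,
  #|[pred v | @g k v == i]|%:R / (n k)%:R @[k --> \oo] --> p i.

Lemma cvg_word_count l :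
  (word_count (@g k) (size l) l)%:R / (n k)%:R ^+ size l @[k --> \oo] -->
  \prod_(i <- l) p i.
Proof.
elim: l => [|i l IH].
  under eq_fun do rewrite word_count0 expr0 divr1.
  by rewrite big_nil; exact: cvg_cst.
rewrite big_cons.
have up : (#|[pred v | @g k v == i]|%:R / (n k)%:R) *
   ((word_count (@g k) (size l) l)%:R / (n k)%:R ^+ size l) @[k --> \oo] -->
   p i * \prod_(i <- l) p i by exact: cvgM (@stat i) IH.
have low : (#|[pred v | @g k v == i]|%:R / (n k)%:R - (size l)%:R * (n k)%:R^-1) *
   ((word_count (@g k) (size l) l)%:R / (n k)%:R ^+ size l) @[k --> \oo] -->
   p i * \prod_(i <- l) p i.
  apply: cvgM IH; rewrite -[X in _ --> X]subr0; apply: cvgB => //.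
  rewrite -(mulr0 (size l)%:R); apply: cvgM; [exact: cvg_cst|exact: cvg_inv_size].
apply: (squeeze_cvgr _ low up); near=> k; have kn : (0 < n k)%N by near: k.
have n0 : 0 < (n k)%:R :> R by rewrite ltr0n.
have nl0 : 0 < (n k)%:R ^+ size l :> R by rewrite exprn_gt0.
have := word_count_le (@g k) (size l) i l; have := word_count_ge (@g k) (size l) i l.
rewrite -!(ler_nat R) natrD !natrM /= exprS.
set a := (word_count _ _ (i :: l))%:R; set b := (word_count _ _ l)%:R.
set c := #|_|%:R => lo hi; apply/andP; split.
  rewrite -mulrBl mulf_div ler_pM2r ?invr_gt0 ?mulr_gt0//; lra.
by rewrite mulf_div ler_pM2r ?invr_gt0 ?mulr_gt0//.
Unshelve. all: by end_near. Qed.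

End Limits.

(** * Convergence in mean of the fringe counts *)

Section DegreeSequence.
Variable d : seq nat.
Hypothesis dd : degree_sequence d.

Definition slot : finType := {v : 'I_(size d) & 'I_(nth 0%N d v)}.
Definition slot_owner (s : slot) : 'I_(size d) := tag s.

Lemma deg_slot v : deg slot_owner v = nth 0%N d v.
Proof.
rewrite /deg /slots -cardE -[RHS]card_ord.
have inj : injective (fun j : 'I_(nth 0%N d v) => Tagged (fun v : 'I_(size d) => 'I_(nth 0%N d v)) j : slot).
  by move=> j j' /eqP; rewrite eq_Tagged => /eqP.
rewrite -(fintype.card_image inj); apply: eq_card => -[w j]; rewrite inE.
apply/eqP/fintype.imageP => [/= wv|[j' _ ->//]].
by move: j; rewrite wv => j; exists j.
Qed.

Lemma card_slot : #|{: 'I_(size d)}| = #|slot|.+1.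
Proof.
case: dd => d0 ds; rewrite card_ord card_tagged sumnE big_map big_enum /=.
under eq_bigr do rewrite card_ord.
by rewrite -(big_mkord xpredT (nth 0%N d)) -(big_nth 0%N xpredT id) -sumnE ds prednK.
Qed.

Lemma degree_tree_labtree f : degree_tree slot_owner f = labtree_pred f.
Proof.
rewrite /degree_tree /labtree_pred; congr andb.
by apply: eq_forallb => v; rewrite deg_slot.
Qed.

Lemma card_degstat i :
  #|[pred v | deg slot_owner v == i]| = degstat d i.
Proof.
rewrite /degstat -sum1_card -sum1_count (big_nth 0%N) big_mkord.
by apply: eq_bigl => v; rewrite inE deg_slot.
Qed.

Lemma card_labtree : #|{: labtree d}| = #|degree_tree slot_owner|.
Proof.
rewrite card_sig; apply: eq_card => f; rewrite inE.
by rewrite -degree_tree_labtree.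
Qed.

Lemma labtree_gt0 : (0 < #|{: labtree d}|)%N.
Proof.
rewrite card_labtree lt0n; apply/negP => /eqP e.
have := card_full_slot_tree slot_owner card_slot; rewrite e mul0n => /eqP.
by rewrite eqn0Ngt fact_gt0.
Qed.

Variable R : realType.

Definition mean (h : labtree d -> R) : R := (\sum_f h f) / #|{: labtree d}|%:R.

Lemma meanD h h' : mean (fun f => h f + h' f) = mean h + mean h'.
Proof. by rewrite /mean big_split mulrDl. Qed.

Lemma meanZ c h : mean (fun f => c * h f) = c * mean h.
Proof. by rewrite /mean -big_distrr mulrA. Qed.

Lemma mean_cst c : mean (fun=> c) = c.
Proof.
rewrite /mean sumr_const -[c *+ _]mulr_natr mulfK// pnatr_eq0 -lt0n.
exact: labtree_gt0.
Qed.

Lemma mean_le h h' : (forall f, h f <= h' f) -> mean h <= mean h'.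
Proof.
by move=> hh; rewrite ler_wpM2r ?invr_ge0// ler_sum.
Qed.

Lemma mean_nat (h : {ffun 'I_(size d) -> option 'I_(size d)} -> nat) :
  mean (fun f => (h (val f))%:R) =
  (\sum_(f | degree_tree slot_owner f) h f)%N%:R / #|degree_tree slot_owner|%:R.
Proof.
rewrite /mean card_labtree; congr (_ / _).
rewrite -natr_sum; congr (_%:R).
rewrite -[LHS](big_sub (@labtree_pred d) h).
by apply: eq_bigl => f; rewrite degree_tree_labtree.
Qed.

Notation N T := (fun f : labtree d => fringe_count T (val f)).
Notation W T := (#|@uniq_words _ _ slot_owner T|).

Lemma mean_div c h : mean (fun f => h f / c) = mean h / c.
Proof. by rewrite /mean -mulr_suml mulrAC. Qed.

Lemma size_slot : size d = #|slot|.+1.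
Proof. by rewrite -card_slot card_ord. Qed.

Let ffactE m : (size d) ^_ m.+1 = (size d * #|slot| ^_ m)%N.
Proof. by rewrite size_slot ffactSS. Qed.

(** The factor [n] of the proportion completes [(n - 1) ^_ (m - 1)] to
    [n ^_ m]. *)
Lemma mean_fringe_count T : (utree_size T <= size d)%N ->
  mean (fun f => (N T f)%:R / (size d)%:R) = (W T)%:R / ((size d) ^_ (utree_size T))%:R.
Proof.
move=> Td; rewrite mean_div (mean_nat (fringe_count T)).
have := sum_fringe_count slot_owner card_slot T; set s := \sum_(f | _) _; set D := #|degree_tree _|.
have D0 : (0 < D)%N by rewrite /D -card_labtree labtree_gt0.
have -> : ((size d) ^_ (utree_size T) = size d * #|slot| ^_ (utree_size T).-1)%N.
  by rewrite -ffactE prednK ?utree_size_gt0.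
have : ((utree_size T).-1 < size d)%N by rewrite prednK ?utree_size_gt0.
move: (utree_size T).-1 (W T) => m w md e; rewrite natrM.
have n0 : (size d)%:R != 0 :> R by rewrite pnatr_eq0 size_slot.
have f0 : ((#|slot| ^_ m)%:R : R) != 0.
  by rewrite pnatr_eq0 -lt0n ffact_gt0 -ltnS -size_slot.
have D0' : D%:R != 0 :> R by rewrite pnatr_eq0 -lt0n.
have {}e : s%:R * (#|slot| ^_ m)%:R = D%:R * w%:R :> R by rewrite -!natrM e.
apply: (mulfI D0'); apply: (mulIf f0); apply: (mulIf n0).
transitivity (s%:R * (#|slot| ^_ m)%:R : R); first by field; rewrite n0 D0'.
by rewrite e; field; rewrite f0 n0.
Qed.

Lemma mean_fringe_count2 T : ((utree_size T).-1 + (utree_size T).-1 < size d)%N ->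
  mean (fun f => ((N T f)%:R / (size d)%:R) ^+ 2) <=
  (W T)%:R ^+ 2 /
    ((size d)%:R * ((size d) ^_ ((utree_size T).-1 + (utree_size T).-1).+1)%:R) +
  mean (fun f => (N T f)%:R / (size d)%:R) / (size d)%:R.
Proof.
set m := (_ + _)%N => md; rewrite ffactE.
have -> : mean (fun f => ((N T f)%:R / (size d)%:R) ^+ 2) =
    mean (fun f => (N T f ^ 2)%N%:R / (size d)%:R ^+ 2).
  by congr mean; apply/funext => f; rewrite expr_div_n natrX.
rewrite !mean_div (mean_nat (fringe_count T)).
rewrite (mean_nat (fun f => fringe_count T f ^ 2)%N).
have := sum_fringe_count2 slot_owner card_slot T; rewrite -/m.
set s := \sum_(f | _) _; set s' := \sum_(f | _) fringe_count _ _; set D := #|degree_tree _|.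
have D0 : (0 < D)%N by rewrite /D -card_labtree labtree_gt0.
rewrite -(ler_nat R) natrD !natrM => le.
have n0 : 0 < (size d)%:R :> R by rewrite ltr0n size_slot.
have f0 : 0 < ((#|slot| ^_ m)%:R : R) by rewrite ltr0n ffact_gt0 -ltnS -size_slot.
have D0' : 0 < D%:R :> R by rewrite ltr0n.
move: le n0 f0 D0'.
move: (size d)%:R (#|slot| ^_ m)%:R D%:R s%:R s'%:R (W T)%:R => n a D' x y w le n0 a0 D0'.
rewrite -subr_ge0.
have -> : w ^+ 2 / (n * (n * a)) + y / D' / n / n - x / D' / n ^+ 2 =
   (D' * w ^+ 2 + y * a - x * a) / (n ^+ 2 * a * D').
  by field; rewrite !gt_eqF.
by rewrite divr_ge0 ?subr_ge0 ?expr2// ltW// !mulr_gt0.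
Qed.

End DegreeSequence.

Section Convergence.
Variables (R : realType) (d : nat -> seq nat) (p : nat -> R).
Hypothesis dd : forall k, degree_sequence (d k).
Hypothesis d_size : size (d k) @[k --> \oo] --> \oo.
Hypothesis d_stat : forall i,
  (degstat (d k) i)%:R / (size (d k))%:R @[k --> \oo] --> p i.

Lemma prod_count (q : nat -> R) l M : (forall i, i \in l -> (i < M)%N) ->
  \prod_(i <- l) q i = \prod_(i < M) q i ^+ count_mem (i : nat) l.
Proof.
elim: l => [|j l IH] H; first by rewrite big_nil big1.
rewrite big_cons IH; last by move=> i il; apply: H; rewrite inE il orbT.
have jM : (j < M)%N by apply: H; rewrite mem_head.
rewrite (bigD1 (Ordinal jM)) //= [RHS](bigD1 (Ordinal jM)) //= eqxx exprD expr1 mulrA.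
congr (_ * _); apply: eq_bigr => i ij; rewrite (_ : (j == i) = false)//.
by apply/negbTE; apply: contraNneq ij => ji; apply/eqP/val_inj.
Qed.

(** All plane trees in [Ord T] have the same multiset of degrees, hence the same
    weight. *)
Lemma piunE T : piun p T = \sum_(l <- degree_words T) \prod_(i <- l) p i.
Proof.
rewrite /piun /degree_words big_map.
rewrite [RHS](eq_big_seq (fun=> \prod_(i < utree_size T) p i ^+ utree_degstat T i)).
  by rewrite big_const_seq count_predT iter_addr addr0 mulr_natl.
move=> t; rewrite in_fset_set ?inE; last exact: finite_Ord.
move=> /Ord_degrees tT; rewrite (perm_big _ tT) /=; apply: prod_count => i.
exact: degree_lt_size.
Qed.

Let W k T := #|@uniq_words _ _ (@slot_owner (d k)) T|.

Lemma cvg_uniq_words T :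
  (W k T)%:R / (size (d k))%:R ^+ utree_size T @[k --> \oo] --> piun p T.
Proof.
rewrite piunE.
have H l : (word_count (deg (@slot_owner (d k))) (size l) l)%:R /
    (size (d k))%:R ^+ size l @[k --> \oo] --> \prod_(i <- l) p i.
  apply: (cvg_word_count d_size) => // i.
  under eq_fun do rewrite card_degstat; exact: d_stat.
have := @cvg_sum_seq R _ (degree_words T) _ _ H.
apply: cvg_trans; apply: near_eq_cvg; apply: nearW => k /=.
rewrite /W card_uniq_words natr_sum mulr_suml; apply: eq_big_seq => l lT.
by rewrite (size_degree_words lT).
Qed.

Lemma cvg_mean_fringe T :
  mean (fun f : labtree (d k) =>
    (fringe_count T (val f))%:R / (size (d k))%:R : R) @[k --> \oo] --> piun p T.
Proof.
have F := @cvg_ffact_ratio R _ d_size (utree_size T).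
have H : (W k T)%:R / (size (d k))%:R ^+ utree_size T /
    (((size (d k)) ^_ (utree_size T))%:R / (size (d k))%:R ^+ utree_size T)
    @[k --> \oo] --> piun p T.
  rewrite -[piun p T]divr1; apply: cvgM (@cvg_uniq_words T) _.
  exact: cvgV (oner_neq0 R) F.
apply: cvg_trans H; apply: near_eq_cvg.
have /cvgnyPge/(_ (utree_size T)) nT := d_size.
near=> k; have Tk : (utree_size T <= size (d k))%N by near: k.
rewrite mean_fringe_count// /W.
have s0 : (size (d k))%:R != 0 :> R.
  by rewrite pnatr_eq0 -lt0n (leq_trans _ Tk)// utree_size_gt0.
have c0 : ((size (d k)) ^_ (utree_size T))%:R != 0 :> R.
  by rewrite pnatr_eq0 -lt0n ffact_gt0.
move: (expf_neq0 (utree_size T) s0) c0; move: (_ ^+ _) (_ ^_ _)%:R => b c b0 c0.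
by field; rewrite b0 c0.
Unshelve. all: by end_near. Qed.

(** Expand the square: by the first moment the last two terms tend to minus the
    square of the limit, and the second moment is at most that square in the
    limit. *)
Lemma cvg_mean_sq T :
  mean (fun f : labtree (d k) =>
    ((fringe_count T (val f))%:R / (size (d k))%:R - piun p T) ^+ 2 : R)
  @[k --> \oo] --> (0 : R).
Proof.
set m := ((utree_size T).-1 + (utree_size T).-1)%N.
have F := @cvg_ffact_ratio R _ d_size m.+1.
have G := @cvg_uniq_words T.
have M := @cvg_mean_fringe T.
pose u k := mean (fun f : labtree (d k) =>
    (fringe_count T (val f))%:R / (size (d k))%:R : R).
have U : ((W k T)%:R / (size (d k))%:R ^+ utree_size T) *
  ((W k T)%:R / (size (d k))%:R ^+ utree_size T) *
  (((size (d k)) ^_ m.+1)%:R / (size (d k))%:R ^+ m.+1)^-1 +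
  u k * (size (d k))%:R^-1 - 2 * piun p T * u k + piun p T ^+ 2
  @[k --> \oo] --> (0 : R).
  have -> : 0 = piun p T * piun p T * 1^-1 + piun p T * 0 - 2 * piun p T * piun p T
     + piun p T ^+ 2 :> R by rewrite invr1; ring.
  apply: cvgD; last exact: cvg_cst.
  apply: cvgB; last by apply: cvgM => //; exact: cvg_cst.
  apply: cvgD; last by apply: cvgM => //; exact: cvg_inv_size.
  by apply: cvgM; [exact: cvgM|apply: cvgV => //; exact: oner_neq0].
apply: (squeeze_cvgr _ (cvg_cst 0) U).
have /cvgnyPge/(_ m.+1) nT := d_size.
near=> k; have Tk : (m < size (d k))%N by near: k.
apply/andP; split.
  by rewrite -(mean_cst (dd k) (0 : R)); apply: mean_le => f; exact: sqr_ge0.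
have -> : mean (fun f : labtree (d k) =>
    ((fringe_count T (val f))%:R / (size (d k))%:R - piun p T) ^+ 2) =
  mean (fun f : labtree (d k) =>
    ((fringe_count T (val f))%:R / (size (d k))%:R) ^+ 2) - 2 * piun p T * u k +
    piun p T ^+ 2.
  transitivity (mean (fun f : labtree (d k) =>
      ((fringe_count T (val f))%:R / (size (d k))%:R) ^+ 2 +
      (- (2 * piun p T)) * ((fringe_count T (val f))%:R / (size (d k))%:R) +
      piun p T ^+ 2)); first by congr mean; apply/funext => f; ring.
  by rewrite !meanD meanZ mean_cst// mulNr.
rewrite lerD2r lerD2r (le_trans (mean_fringe_count2 _ _ _))//.
rewrite -/m lerD2r -expr2 expr_div_n.
have s0 : (size (d k))%:R != 0 :> R by rewrite pnatr_eq0 -lt0n (leq_trans _ Tk).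
have -> : (size (d k))%:R ^+ utree_size T ^+ 2 = (size (d k))%:R * (size (d k))%:R ^+ m.+1 :> R.
  rewrite -exprM -exprS; congr (_ ^+ _); rewrite /m.
  by have := utree_size_gt0 T; case: (utree_size T) => // a _; lia.
have c0 : ((size (d k)) ^_ m.+1)%:R != 0 :> R.
  by rewrite pnatr_eq0 -lt0n ffact_gt0.
move: (expf_neq0 m.+1 s0) c0; move: (_ ^+ m.+1) (_ ^_ m.+1)%:R => b c b0 c0.
rewrite le_eqVlt; apply/orP; left; apply/eqP.
by field; rewrite b0 c0.
Unshelve. all: by end_near. Qed.

(** Convergence in mean, deduced from that in mean square by
    [x <= x ^ 2 / (2 e) + e / 2]. *)
Lemma cvg_mean_dist T :
  mean (fun f : labtree (d k) =>
    `|(fringe_count T (val f))%:R / (size (d k))%:R - piun p T| : R)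
  @[k --> \oo] --> (0 : R).
Proof.
apply/cvgr0Pnorm_le => e e0.
have /cvgr0Pnorm_le/(_ (e ^+ 2) (exprn_gt0 2 e0)) := @cvg_mean_sq T.
apply: filterS => k; set a := mean _; set b := mean _ => ae.
have b0 : 0 <= b by rewrite -(mean_cst (dd k) (0 : R)); apply: mean_le => f.
rewrite ger0_norm//; have {}ae := le_trans (ler_norm _) ae.
have : b <= mean (fun f : labtree (d k) => (2 * e)^-1 *
  ((fringe_count T (val f))%:R / (size (d k))%:R - piun p T) ^+ 2 + e / 2).
  apply: mean_le => f; rewrite -[_ ^+ 2]real_normK ?num_real//.
  move: `|_ : R| => x; rewrite -subr_ge0.
  have -> : (2 * e)^-1 * x ^+ 2 + e / 2 - x = (x - e) ^+ 2 / (2 * e).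
    by field; rewrite gt_eqF.
  by rewrite divr_ge0 ?sqr_ge0// mulr_ge0// ltW.
rewrite meanD meanZ mean_cst// -/a => /le_trans; apply.
have : (2 * e)^-1 * a <= (2 * e)^-1 * e ^+ 2.
  by rewrite ler_wpM2l// invr_ge0 mulr_ge0// ltW.
have -> : (2 * e)^-1 * e ^+ 2 = e / 2 by field; rewrite gt_eqF.
lra.
Qed.

End Convergence.

(** * Truncations of a family tree *)

Lemma uniq_flatten_map (I T U : eqType) (F : I -> seq T) (tg : T -> U)
    (h : I -> U) (r : seq I) : injective h ->
  uniq r -> (forall i, i \in r -> uniq (F i)) ->
  (forall i x, i \in r -> x \in F i -> tg x = h i) -> uniq (flatten (map F r)).
Proof.
move=> hI; elim: r => //= i r IH /andP[ir ur] uF tF; rewrite cat_uniq.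
rewrite uF ?mem_head//= IH//; last 2 first.
- by move=> j jr; apply: uF; rewrite inE jr orbT.
- by move=> j x jr; apply: tF; rewrite inE jr orbT.
rewrite andbT; apply/hasPn => x /flatten_mapP[j jr xj]; apply: contraNN ir => xi.
suff -> : i = j by [].
apply: hI; rewrite -(tF i x) ?mem_head//; apply: tF => //.
by rewrite inE jr orbT.
Qed.

(** The addresses, in preorder, of the vertices of a copy of [t] rooted at [u],
    with their degrees.  Having a given finite tree as family tree is a
    constraint on the numbers of children at these addresses only. *)
Fixpoint constraints (t : ptree) (u : seq nat) : seq (seq nat * nat) :=
  let: PNode s := t in
  (u, size s) :: flatten
    [seq nth (fun=> [::]) (map constraints s) i (rcons u i) | i <- iota 0 (size s)].

Definition matches (x : seq nat -> nat) (u : seq nat) (t : ptree) : bool :=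
  all (fun c => x c.1 == c.2) (constraints t u).

Definition leaf := PNode [::].

Lemma constraintsE s u : constraints (PNode s) u = (u, size s) ::
  flatten [seq constraints (nth leaf s i) (rcons u i) | i <- iota 0 (size s)].
Proof.
rewrite /=; congr (_ :: flatten _); apply/eq_in_map => i.
by rewrite mem_iota add0n => lt; rewrite (nth_map leaf).
Qed.

Lemma matchesP x u s : reflect (x u = size s /\
    forall i, (i < size s)%N -> matches x (rcons u i) (nth leaf s i))
  (matches x u (PNode s)).
Proof.
rewrite /matches constraintsE /=; apply: (iffP andP) => -[/eqP xu H]; split=> //.
  move=> i lt; apply/allP => c ci; apply: (allP H); apply/flatten_mapP.
  by exists i => //; rewrite mem_iota.
apply/allP => c /flatten_mapP[i]; rewrite mem_iota => lt; apply: (allP (H i lt)).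
Qed.

Lemma constraints_snd t u : unzip2 (constraints t u) = ptree_degrees t.
Proof.
elim/ptree_ind_mem: t u => s IH u; rewrite constraintsE /=; congr cons.
rewrite /unzip2 map_flatten -map_comp; congr flatten.
rewrite -[in RHS](mkseq_nth leaf s) /mkseq -map_comp; apply/eq_in_map => i.
by rewrite mem_iota => lt /=; apply: IH; rewrite mem_nth.
Qed.

Lemma constraints_prefix t u c : c \in constraints t u -> exists a, c.1 = u ++ a.
Proof.
elim/ptree_ind_mem: t u => s IH u; rewrite constraintsE inE => /predU1P[->|].
  by exists [::]; rewrite cats0.
move=> /flatten_mapP[i]; rewrite mem_iota => lt /IH[|a ->]; first by rewrite mem_nth.
by exists (i :: a); rewrite cat_rcons.
Qed.

Lemma constraints_uniq t u : uniq (unzip1 (constraints t u)).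
Proof.
elim/ptree_ind_mem: t u => s IH u; rewrite constraintsE /=; apply/andP; split.
  apply/negP => /mapP[c /flatten_mapP[i _ /constraints_prefix[a ->]]].
  move=> /(congr1 size); rewrite size_cat size_rcons; lia.
rewrite /unzip1 map_flatten -map_comp.
apply: (@uniq_flatten_map _ _ _ _ (fun w => nth 0%N w (size u)) id) => //.
- exact: iota_uniq.
- by move=> i; rewrite mem_iota => lt; apply: IH; rewrite mem_nth.
- move=> i w _ /mapP[c /constraints_prefix[a ->] ->].
  by rewrite nth_cat size_rcons leqnn nth_rcons ltnn eqxx.
Qed.

Section Truncation.
Variable x : seq nat -> nat.

Let tr h u := unfold_tree (fun u => [seq rcons u i | i <- iota 0 (x u)]) h u.

Let trS h u : tr h.+1 u = PNode [seq tr h (rcons u i) | i <- iota 0 (x u)].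
Proof. by rewrite /tr /= -map_comp. Qed.

Lemma truncation_matches h u t : matches x u t -> (ptree_size t <= h)%N -> tr h u = t.
Proof.
elim: h u t => [|h IH] u [s]; rewrite ptree_size_node // ltnS.
move=> /matchesP[xu H] le; rewrite trS xu; congr PNode.
rewrite -[RHS](mkseq_nth leaf s) /mkseq; apply/eq_in_map => i.
rewrite mem_iota => lt; apply: IH; first exact: H.
by apply: leq_trans le; rewrite (big_rem (nth leaf s i)) ?mem_nth// leq_addr.
Qed.

Lemma truncation_size h u : (ptree_size (tr h u) <= ptree_size (tr h.+1 u))%N.
Proof.
elim: h u => [|h IH] u; first by rewrite /tr !ptree_size_node big_nil.
rewrite trS [in X in (_ <= X)%N]trS !ptree_size_node ltnS !big_map.
by apply: leq_sum => i _; exact: IH.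
Qed.

(** A vertex at the cut with children would make the next truncation larger. *)
Lemma truncation_stable h u : ptree_size (tr h u) = ptree_size (tr h.+1 u) ->
  matches x u (tr h u).
Proof.
elim: h u => [|h IH] u.
  rewrite trS /tr !ptree_size_node big_nil big_map => -[e]; apply/matchesP; split => //.
  by move: e; case: (x u) => // m; rewrite /= big_cons ptree_size_node.
rewrite trS [in X in _ = X -> _]trS !ptree_size_node !big_map => -[e].
apply/matchesP; rewrite size_map size_iota; split => // i lt.
rewrite (nth_map 0%N) ?size_iota// nth_iota// add0n; apply: IH.
have : i \in iota 0 (x u) by rewrite mem_iota.
move: e; elim: (iota 0 (x u)) => //= j r IHr; rewrite !big_cons => e.
have le1 := truncation_size h (rcons u j).
have le2 : (\sum_(k <- r) ptree_size (tr h (rcons u k)) <=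
  \sum_(k <- r) ptree_size (tr h.+1 (rcons u k)))%N.
  by apply: leq_sum => k _; exact: truncation_size.
rewrite inE => /predU1P[->|]; first by apply/eqP; rewrite eqn_leq le1; lia.
by apply: IHr; apply/eqP; rewrite eqn_leq le2; lia.
Qed.

End Truncation.

Lemma matches_inj x u t t' : matches x u t -> matches x u t' -> t = t'.
Proof.
move=> m m'; pose h := maxn (ptree_size t) (ptree_size t').
by rewrite -(truncation_matches (h := h) m) ?leq_maxl//
           -(truncation_matches (h := h) m') ?leq_maxr.
Qed.

Lemma gw_isP x (T : utree) : gw_is x T <-> exists2 t, forget_order t = T & matches x [::] t.
Proof.
split=> [[h0 _ H]|[t tT m]]; last first.
  exists (ptree_size t) => // h /= le; rewrite -tT; congr forget_order.
  exact: truncation_matches.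
exists (gw_truncation x h0); first exact: H (leqnn _).
apply: truncation_stable; apply: uiso_size; apply/forget_order_eq.
exact: etrans (H h0 (leqnn _)) (esym (H h0.+1 (leqnSn _))).
Qed.

(** * Grafting and subcritical fixed points *)

Fixpoint forests (l : seq ptree) (i : nat) : seq (seq ptree) :=
  if i is i'.+1 then [seq t :: r | t <- l, r <- forests l i'] else [:: [::]].

Lemma size_forests l i r : r \in forests l i -> size r = i.
Proof.
elim: i r => [|i IH] r /=; first by rewrite inE => /eqP ->.
by move=> /allpairsP[[t r'] [/= _ /IH <- ->]].
Qed.

Lemma uniq_forests l i : uniq l -> uniq (forests l i).
Proof.
move=> ul; elim: i => //= i IH; apply: allpairs_uniq => //.
by move=> [t r] [t' r'] _ _ /= [-> ->].
Qed.

Section Weights.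
Variables (R : realType) (p : nat -> R).

(** The probability that a Galton--Watson tree is the plane tree [t]. *)
Definition weight (t : ptree) : R := \prod_(i <- ptree_degrees t) p i.

Lemma weight_node s : weight (PNode s) = p (size s) * \prod_(t <- s) weight t.
Proof. by rewrite /weight /= big_cons big_flatten big_map. Qed.

Lemma sum_forests l i :
  \sum_(r <- forests l i) \prod_(t <- r) weight t = (\sum_(t <- l) weight t) ^+ i.
Proof.
elim: i => [|i IH] /=; first by rewrite big_seq1 big_nil.
rewrite big_allpairs_dep /= exprS mulr_suml; apply: eq_bigr => t _.
by rewrite -IH mulr_sumr; apply: eq_bigr => r _; rewrite big_cons.
Qed.

(** Grafting turns a finite list of trees of total weight [s] into a list of
    total weight [sum_i p_i s^i]; this is the branching property in finite
    terms. *)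
Definition graft (l : seq ptree) (m : nat) : seq ptree :=
  flatten [seq map PNode (forests l i) | i <- iota 0 m].

Lemma uniq_graft l m : uniq l -> uniq (graft l m).
Proof.
move=> ul; apply: (@uniq_flatten_map _ _ _ _ (fun t => let: PNode s := t in size s) id) => //.
- exact: iota_uniq.
- by move=> i _; rewrite map_inj_uniq ?uniq_forests// => s s' [].
- by move=> i t _ /mapP[r /size_forests <- ->].
Qed.

Lemma sum_graft l m : \sum_(t <- graft l m) weight t =
  \sum_(i < m) p i * (\sum_(t <- l) weight t) ^+ i.
Proof.
rewrite /graft big_flatten big_map -[in LHS](subn0 m) -/(index_iota 0 m) big_mkord.
apply: eq_bigr => i _; rewrite big_map -sum_forests mulr_sumr.
by apply: eq_big_seq => r /size_forests ri; rewrite weight_node ri.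
Qed.

(** If [s < 1], the bound [s^i >= 1 - i (1 - s) + (1 - s)^2] for [i >= 2] leaves
    no mass on [i >= 2]; then [p 0 + p 1 = 1], and the inequality for [s] forces
    [p 0 = 0]. *)
Lemma subcritical_fixpoint (s : R) :
  (forall i, 0 <= p i) -> (\sum_(i < m) p i @[m --> \oo] --> (1 : R)) ->
  (forall m, \sum_(i < m) i%:R * p i <= 1) -> p 1%N != 1 ->
  0 <= s <= 1 -> (forall m, \sum_(i < m) p i * s ^+ i <= s) -> s = 1.
Proof.
move=> p0 p1 pm pn1 /andP[s0 s1] ps.
have pw i : 1 - i.+2%:R * (1 - s) + (1 - s) ^+ 2 <= s ^+ i.+2.
  elim: i => [|i IH]; first by rewrite expr2 expr2; lra.
  rewrite [s ^+ _]exprSr; have := exprn_ile1 i.+2 s0 s1.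
  move: (s ^+ i.+2) IH => y IH y1.
  have yd : y * (1 - s) <= 1 * (1 - s) by rewrite ler_wpM2r// subr_ge0.
  rewrite -[i.+3]addn1 natrD; move: (i.+2%:R : R) IH => a IH; lra.
have pl i : p i * (1 + (1 - s) ^+ 2) - (1 - s) * (i%:R * p i)
    - (1 - s) ^+ 2 * ((i < 2)%N%:R * p i) <= p i * s ^+ i.
  have -> : p i * (1 + (1 - s) ^+ 2) - (1 - s) * (i%:R * p i)
    - (1 - s) ^+ 2 * ((i < 2)%N%:R * p i) =
    p i * (1 - i%:R * (1 - s) + (1 - s) ^+ 2 - (1 - s) ^+ 2 * (i < 2)%N%:R) by ring.
  apply: ler_wpM2l => //; case: i => [|[|i]] /=; rewrite ?expr0 ?expr1 ?mulr0 ?subr0 ?pw//.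
    by rewrite mulr1; lra.
  by rewrite mulr1; lra.
have le m : (\sum_(i < m.+2) p i) * (1 + (1 - s) ^+ 2) - (1 - s)
   - (1 - s) ^+ 2 * (p 0%N + p 1%N) <= s.
  apply: le_trans (ps m.+2); apply: le_trans (ler_sum _ (fun i _ => pl (nat_of_ord i))).
  rewrite !sumrB -!mulr_sumr -mulr_suml lerB//.
    by rewrite lerD2l lerN2 ler_piMr ?subr_ge0 ?pm.
  rewrite ler_wpM2l ?sqr_ge0// 2!big_ord_recl /= big1 ?addr0; first by rewrite !mul1r.
  by move=> i _; rewrite mul0r.
have lim : (1 - s) ^+ 2 * (1 - (p 0%N + p 1%N)) <= 0.
  have p1' : \sum_(i < m.+2) p i @[m --> \oo] --> (1 : R).
    by have := p1; rewrite -cvg_shiftS -cvg_shiftS.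
  have q : (\sum_(i < m.+2) p i) * (1 + (1 - s) ^+ 2) @[m --> \oo] -->
      1 * (1 + (1 - s) ^+ 2) by exact: cvgM p1' (cvg_cst _).
  have H : 1 * (1 + (1 - s) ^+ 2) <= s + (1 - s) + (1 - s) ^+ 2 * (p 0%N + p 1%N).
    by apply: (cvgr_to_le q); apply: nearW => m; have := le m; lra.
  lra.
have [//|sn1] := eqVneq s 1; exfalso.
have d0 : 0 < 1 - s by rewrite subr_gt0 lt_neqAle sn1.
have le01 : 1 <= p 0%N + p 1%N.
  by move: lim; rewrite pmulr_rle0 ?exprn_gt0// subr_le0.
have := pm 2%N; have := ps 2%N; rewrite !big_ord_recl !big_ord0 /= expr0 expr1 => e1 e2.
have [p10 p11] : 0 <= p 1%N /\ p 1%N < 1.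
  by split => //; rewrite lt_neqAle pn1; move: e2; rewrite mul0r mul1r; lra.
have := p0 0%N; nra.
Qed.

End Weights.

(** * The Galton--Watson tree *)

Section GaltonWatson.
Context d (Omega : measurableType d) (R : realType) (P : probability Omega R).
Variables (p : nat -> R) (xi : seq nat -> Omega -> nat).
Hypothesis p_ge0 : forall i, 0 <= p i.
Hypothesis xi_gw : gw_offspring P p xi.

Definition gw_plane (t : ptree) : set Omega :=
  [set w | matches (fun u => xi u w) [::] t].

Lemma gw_eventE (B : set utree) :
  gw_event xi B = [set w | exists2 t, B (forget_order t) & gw_plane t w].
Proof.
apply/seteqP; split => w /=.
  by move=> [T BT /gw_isP[t tT m]]; exists t; rewrite ?tT.
by move=> [t Bt m]; exists (forget_order t) => //; apply/gw_isP; exists t.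
Qed.

(** The form in which the product rule of [gw_offspring] applies: the required
    number of children is looked up from the address. *)
Lemma gw_planeE t : let c := constraints t [::] in
  gw_plane t = \bigcap_(u in [set` unzip1 c])
     xi u @^-1` [set nth 0%N (unzip2 c) (index u (unzip1 c))].
Proof.
move=> c; have uc : uniq (unzip1 c) := constraints_uniq t [::].
have nthE i : (i < size c)%N ->
    nth 0%N (unzip2 c) (index (nth [::] (unzip1 c) i) (unzip1 c)) = (nth ([::], 0%N) c i).2.
  by move=> ic; rewrite index_uniq ?size_map// (nth_map ([::], 0%N)).
apply/seteqP; split => w /=.
  move=> /allP m u /= /(nthP [::])[i]; rewrite size_map => ic <-.
  rewrite nthE// (nth_map ([::], 0%N))//; apply/eqP/m; exact: mem_nth.
move=> H; apply/(all_nthP ([::], 0%N)) => i ic; apply/eqP; rewrite -nthE//.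
have ui : nth [::] (unzip1 c) i \in unzip1 c by rewrite mem_nth ?size_map.
by rewrite -(H _ ui) (nth_map ([::], 0%N)).
Qed.

Lemma measurable_gw_plane t : measurable (gw_plane t).
Proof.
rewrite gw_planeE; apply: fin_bigcap_measurable => //.
by move=> u _; case: xi_gw.
Qed.

Lemma prob_gw_plane t : P (gw_plane t) = (weight p t)%:E.
Proof.
rewrite gw_planeE; case: xi_gw => _ ->; last exact: constraints_uniq.
rewrite /weight -(constraints_snd t [::]); congr (_%:E).
set c := constraints t [::]; rewrite -(big_map _ xpredT p); congr bigop.
apply: (@eq_from_nth _ 0%N); rewrite ?size_map// => i ic.
rewrite (nth_map [::]) ?size_map// index_uniq ?size_map//.
exact: constraints_uniq.
Qed.

Definition gw_list (l : seq ptree) : set Omega :=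
  [set w | exists2 t, t \in l & gw_plane t w].

Lemma gw_list_cons t l : gw_list (t :: l) = gw_plane t `|` gw_list l.
Proof.
apply/seteqP; split => w /=.
  by move=> [t']; rewrite inE => /predU1P[->|tl]; [left|right; exists t'].
by move=> [m|[t' tl m]]; [exists t; rewrite ?mem_head|exists t'; rewrite // inE tl orbT].
Qed.

Lemma measurable_gw_list l : measurable (gw_list l).
Proof.
elim: l => [|t l IH]; last by rewrite gw_list_cons; apply: measurableU => //; exact: measurable_gw_plane.
by rewrite (_ : gw_list _ = set0)//; apply/seteqP; split => w //= -[].
Qed.

Lemma prob_gw_list l : uniq l -> P (gw_list l) = (\sum_(t <- l) weight p t)%:E.
Proof.
elim: l => [_|t l IH /= /andP[tl ul]].
  by rewrite big_nil (_ : gw_list _ = set0) ?measure0//; apply/seteqP; split => w //= -[].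
rewrite gw_list_cons measureU//.
- by rewrite big_cons EFinD; congr (_ + _)%E; [exact: prob_gw_plane|exact: IH].
- exact: measurable_gw_plane.
- exact: measurable_gw_list.
apply/seteqP; split => w //= [m [t' t'l m']].
by move: tl; rewrite (matches_inj m m') t'l.
Qed.

(** An exhaustion of the countably many plane trees by finite lists. *)
Definition first_trees (B : set utree) (n : nat) : seq ptree :=
  [seq t <- pmap (@pickle_inv ptree) (iota 0 n) | `[< B (forget_order t) >]].

Lemma uniq_first_trees B n : uniq (first_trees B n).
Proof. by rewrite filter_uniq// (pmap_uniq (@pickle_invK _)) ?iota_uniq. Qed.

Lemma mem_first_trees B n t :
  (t \in first_trees B n) = `[< B (forget_order t) >] && (pickle t < n)%N.
Proof.
rewrite mem_filter (can2_mem_pmap (@pickle_invK _) (@pickleK_inv _)).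
by rewrite mem_iota.
Qed.

Lemma gw_event_bigcup B : gw_event xi B = \bigcup_n gw_list (first_trees B n).
Proof.
rewrite gw_eventE; apply/seteqP; split => w /=.
  move=> [t Bt m]; exists (pickle t).+1 => //; exists t => //.
  by rewrite mem_first_trees ltnS leqnn andbT; apply/asboolP.
by move=> [n _ [t]]; rewrite mem_first_trees => /andP[/asboolP Bt _] m; exists t.
Qed.

Lemma measurable_gw_event B : measurable (gw_event xi B).
Proof.
by rewrite gw_event_bigcup; apply: bigcupT_measurable => n; exact: measurable_gw_list.
Qed.

Lemma cvg_weight_first_trees B :
  \sum_(t <- first_trees B n) weight p t @[n --> \oo] --> fine (P (gw_event xi B)).
Proof.
have := @nondecreasing_cvg_mu _ _ _ P (fun n => gw_list (first_trees B n)).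
move=> /(_ (fun n => measurable_gw_list _)).
rewrite -gw_event_bigcup => /(_ (measurable_gw_event B)) H.
have {}H : P \o (fun n => gw_list (first_trees B n)) @ \oo --> P (gw_event xi B).
  apply: H => n m nm; apply/subsetPset => w [t].
  rewrite mem_first_trees => /andP[Bt tn] mt; exists t => //.
  by rewrite mem_first_trees Bt (leq_trans tn).
rewrite -[P (gw_event _ _)]fineK in H; last first.
  by apply: fin_num_measure; exact: measurable_gw_event.
have -> : (fun n => \sum_(t <- first_trees B n) weight p t) =
    (fun n => fine (P (gw_list (first_trees B n)))).
  by apply/funext => n; rewrite prob_gw_list//; exact: uniq_first_trees.
exact: fine_cvg H.
Qed.

Lemma prob_gw_event1 (T : utree) : P (gw_event xi [set T]) = (piun p T)%:E.
Proof.
have -> : gw_event xi [set T] = gw_list (finmap.enum_fset (fset_set (Ord T))).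
  rewrite gw_eventE; apply/seteqP; split => w /= [t tT m]; exists t => //.
    by rewrite in_fset_set ?inE//; exact: finite_Ord.
  by move: tT; rewrite in_fset_set ?inE//; exact: finite_Ord.
by rewrite prob_gw_list ?finmap.fset_uniq// piunE /degree_words big_map.
Qed.

(** The mass [s] of the finite trees satisfies [sum_i p_i s^i <= s], because
    grafting finite trees on a root gives finite trees. *)
Lemma gw_finite : (\sum_(i < m) p i @[m --> \oo] --> (1 : R)) ->
  (forall m, \sum_(i < m) i%:R * p i <= 1) -> p 1%N != 1 ->
  P (gw_event xi setT) = 1%E.
Proof.
move=> p1 pm pn1; have C := @cvg_weight_first_trees setT.
have Pfin : P (gw_event xi setT) \is a fin_num.
  by apply: fin_num_measure; exact: measurable_gw_event.
rewrite -[LHS]fineK//; congr (_%:E).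
have le l : uniq l -> \sum_(t <- l) weight p t <= fine (P (gw_event xi setT)).
  move=> ul; rewrite -lee_fin fineK// -prob_gw_list// le_measure ?inE//.
  - exact: measurable_gw_list.
  - exact: measurable_gw_event.
  - by rewrite gw_eventE => w [t _ m]; exists t.
apply: (subcritical_fixpoint p_ge0 p1 pm pn1).
  rewrite fine_ge0 ?measure_ge0//=.
  by rewrite -lee_fin fineK// probability_le1//; exact: measurable_gw_event.
move=> m; have q : \sum_(i < m) p i * (\sum_(t <- first_trees setT n) weight p t) ^+ i
    @[n --> \oo] --> \sum_(i < m) p i * fine (P (gw_event xi setT)) ^+ i.
  apply: cvg_sum_seq => i; apply: cvgM; first exact: cvg_cst.
  elim: (nat_of_ord i) => [|j IH].
    by under eq_fun do rewrite expr0; rewrite expr0; exact: cvg_cst.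
  by under eq_fun do rewrite exprS; rewrite exprS; exact: cvgM.
apply: (cvgr_to_le q); apply: nearW => n; rewrite -sum_graft.
by apply: le; exact: uniq_graft (uniq_first_trees _ _).
Qed.

End GaltonWatson.

(** * Random elements of finite types and additive set functions *)

Section FiniteElement.
Context dp (Omega : measurableType dp) (R : realType) (P : probability Omega R).
Variables (E : finType) (Y : Omega -> E) (q : E -> R).
Hypothesis mY : forall x, measurable (Y @^-1` [set x]).
Hypothesis PY : forall x, P (Y @^-1` [set x]) = (q x)%:E.

Lemma prob_finite_seq (r : seq E) : uniq r ->
  measurable (Y @^-1` [set` r]) /\ P (Y @^-1` [set` r]) = (\sum_(x <- r) q x)%:E.
Proof.
elim: r => [_|x r IH /= /andP[xr ur]].
  rewrite big_nil (_ : _ @^-1` _ = set0) ?measure0//.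
  by apply/seteqP; split => w.
have -> : Y @^-1` [set` x :: r] = Y @^-1` [set x] `|` Y @^-1` [set` r].
  apply/seteqP; split => w /=; rewrite inE.
    by move=> /predU1P[->|]; [left|right].
  by case=> [->|->]; rewrite ?eqxx ?orbT.
have [mr pr] := IH ur; split; first exact: measurableU.
rewrite measureU//; first by rewrite big_cons EFinD; congr (_ + _)%E; [exact: PY|exact: pr].
by apply/seteqP; split => w //= [-> xr']; rewrite xr' in xr.
Qed.

Lemma prob_finite (B : set E) : P (Y @^-1` B) = (\sum_(x | `[< B x >]) q x)%:E.
Proof.
have [] := @prob_finite_seq [seq x <- index_enum E | `[< B x >]].
  by rewrite filter_uniq// index_enum_uniq.
rewrite big_filter => _ <-; congr (P (Y @^-1` _)).
apply/seteqP; split => x /=; rewrite mem_filter mem_index_enum andbT => /asboolP //.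
Qed.

Lemma expectation_finite (h : E -> nat) :
  'E_P[fun w => (h (Y w))%:R]%E = (\sum_x (h x)%:R * q x)%:E.
Proof.
rewrite unlock.
have -> : (fun w => (h (Y w))%:R%:E : \bar R) =
    fun w => (\sum_(x <- index_enum E) (h x)%:R%:E * (\1_(Y @^-1` [set x]) w)%:E)%E.
  apply/funext => w; rewrite sumEFin; congr (_%:E).
  rewrite (bigD1 (Y w)) //= indicE mem_set//= mulr1 big1 ?addr0// => x xY.
  by rewrite indicE memNset ?mulr0//= => e; rewrite e eqxx in xY.
rewrite ge0_integral_sum//.
- rewrite -sumEFin; apply: eq_bigr => x _.
  rewrite ge0_integralZl_EFin ?ler0n//.
  + by rewrite integral_indic// setIT EFinM; congr (_ * _)%E; exact: PY.
  + by apply/measurable_EFinP; exact: measurable_indic.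
- by move=> x; apply/measurable_EFinP/measurable_funM => //; exact: measurable_indic.
Qed.

End FiniteElement.

Section AdditiveSetFunctions.
Variables (R : realType) (T : choiceType).

(** Finite additivity is what the empirical law of the fringe subtrees and the
    law of a finite Galton--Watson tree have in common on arbitrary sets of
    trees. *)
Record additive_prob (nu : set T -> R) : Prop := AdditiveProb {
  additive_prob_ge0 : forall A, 0 <= nu A;
  additive_probU : forall A B, A `&` B = set0 -> nu (A `|` B) = nu A + nu B;
  additive_probT : nu setT = 1 }.

Variable nu : set T -> R.
Hypothesis nuP : additive_prob nu.

Lemma additive_prob0 : nu set0 = 0.
Proof.
have := additive_probU nuP (set0I (@set0 T)); rewrite setU0.
by move=> /eqP; rewrite -subr_eq subrr eq_sym => /eqP.
Qed.

Lemma additive_prob_seq (r : seq T) : uniq r ->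
  nu [set` r] = \sum_(x <- r) nu [set x].
Proof.
elim: r => [_|x r IH /= /andP[xr ur]].
  by rewrite big_nil -additive_prob0; congr nu; apply/seteqP; split.
rewrite big_cons -IH// -(additive_probU nuP).
  congr nu; apply/seteqP; split => y /=; rewrite inE.
    by move=> /predU1P[->|]; [left|right].
  by case=> [->|->]; rewrite ?eqxx ?orbT.
by apply/seteqP; split => y //= [-> xr']; rewrite xr' in xr.
Qed.

Lemma additive_probC A : nu (~` A) = 1 - nu A.
Proof.
by rewrite -(additive_probT nuP) -(setUv A) (additive_probU nuP) ?setICr// addrAC subrr add0r.
Qed.

Lemma additive_prob_sub A B : A `<=` B -> nu A <= nu B.
Proof.
move=> AB; rewrite -(setDUK AB) (additive_probU nuP) ?lerDl ?additive_prob_ge0//.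
by rewrite setIDA setIC -setIDA setDv setI0.
Qed.

Lemma additive_prob_ge_sum A (r : seq T) : uniq r ->
  \sum_(x <- r | `[< A x >]) nu [set x] <= nu A.
Proof.
move=> ur; rewrite -big_filter -additive_prob_seq ?filter_uniq//.
apply: additive_prob_sub => x /=; by rewrite mem_filter => /andP[/asboolP].
Qed.

End AdditiveSetFunctions.

(** A set and its complement both have at least the mass of their points in
    [r], so the lower bound for the complement is an upper bound for the set. *)
Lemma additive_prob_dist (R : realType) (T : choiceType) (nu mu : set T -> R)
    (r : seq T) (e : R) (A : set T) :
  additive_prob nu -> additive_prob mu -> uniq r -> 1 - e <= mu [set` r] ->
  `|nu A - mu A| <= \sum_(x <- r) `|nu [set x] - mu [set x]| + e.
Proof.
move=> nuP muP ur mur.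
have lo B : - (\sum_(x <- r) `|nu [set x] - mu [set x]| + e) <= nu B - mu B.
  have h1 := additive_prob_ge_sum nuP B ur.
  have h2 := additive_prob_ge_sum muP (~` B) ur.
  have h3 := additive_probC muP B.
  rewrite (additive_prob_seq muP ur) (bigID (fun x => `[< B x >])) /= in mur.
  have e2 : \sum_(x <- r | ~~ `[< B x >]) mu [set x] =
      \sum_(x <- r | `[< (~` B) x >]) mu [set x].
    by apply: eq_bigl => x; rewrite -asbool_neg.
  have h4 : \sum_(x <- r | `[< B x >]) mu [set x] - \sum_(x <- r | `[< B x >]) nu [set x]
      <= \sum_(x <- r) `|nu [set x] - mu [set x]|.
    rewrite -sumrB [leRHS](bigID (fun x => `[< B x >])) /= -[leLHS]addr0.
    apply: lerD; last by apply: sumr_ge0 => x _.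
    by apply: ler_sum => x _; rewrite distrC ler_norm.
  lra.
rewrite ler_norml lo /=; have := lo (~` A).
rewrite (additive_probC nuP) (additive_probC muP); lra.
Qed.

(** * Annealed and quenched convergence *)

Section FringeLaw.
Variables (R : realType) (d : seq nat).
Hypothesis dd : degree_sequence d.

(** The conditional law of the fringe subtree given the labelled tree [f]. *)
Definition fringe_law (f : labtree d) (B : set utree) : R :=
  #|[pred v | `[< B (fringe (val f) v) >]]|%:R / (size d)%:R.

Let size_neq0 : (size d)%:R != 0 :> R.
Proof. by case: dd => d0 _; rewrite pnatr_eq0 -lt0n. Qed.

Lemma fringe_law1 f (T : utree) :
  fringe_law f [set T] = (fringe_count T (val f))%:R / (size d)%:R.
Proof.
congr (_%:R / _); apply: eq_card => v; rewrite !inE.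
by apply/asboolP/eqP.
Qed.

Lemma fringe_law_additive f : additive_prob (fringe_law f).
Proof.
split=> [B|B C BC|].
- by rewrite divr_ge0.
- rewrite /fringe_law -mulrDl -natrD; congr (_%:R / _).
  rewrite -cardUI [X in (_ + X)%N]eq_card0 ?addn0.
    apply: eq_card => v; rewrite !inE; apply/asboolP/orP.
      by case=> h; [left|right]; apply/asboolP.
    by case=> /asboolP h; [left|right].
  move=> v; rewrite !inE; apply/negP => /andP[/asboolP b /asboolP c].
  by have : (B `&` C) (fringe (val f) v) by []; rewrite BC.
- rewrite /fringe_law [X in X%:R](_ : _ = size d) ?divff//.
  by rewrite -[RHS]card_ord; apply: eq_card => v; rewrite !inE; apply/asboolP.
Qed.

Context dp (Omega : measurableType dp) (P : probability Omega R).
Variables (X : Omega -> labtree d) (U : Omega -> 'I_(size d)).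
Hypothesis XP : uniform_element P X.
Hypothesis UP : cond_uniform_element P X U.

Let D : R := #|{: labtree d}|%:R.

Let D_neq0 : D != 0.
Proof. by rewrite pnatr_eq0 -lt0n labtree_gt0. Qed.

Let XU w := (X w, U w).

Let mXU x : measurable (XU @^-1` [set x]).
Proof.
case: x => f v; have -> : XU @^-1` [set (f, v)] = X @^-1` [set f] `&` U @^-1` [set v].
  by apply/seteqP; split => w /=; rewrite /XU => -[-> ->].
by apply: measurableI; [case: (XP f)|case: (UP f v)].
Qed.

Let PXU x : P (XU @^-1` [set x]) = (D^-1 * (size d)%:R^-1)%:E.
Proof.
case: x => f v; have -> : XU @^-1` [set (f, v)] = X @^-1` [set f] `&` U @^-1` [set v].
  by apply/seteqP; split => w /=; rewrite /XU => -[-> ->].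
have [_ ->] := UP f v; have [_ ->] := XP f; rewrite card_ord.
by rewrite EFinM.
Qed.

Let sum_const (I : finType) (B : pred I) (c : R) : \sum_(x | B x) c = #|B|%:R * c.
Proof. by rewrite sumr_const mulr_natl. Qed.

Lemma prob_fringe_event B :
  P (fringe_event X U B) = (mean (fun f => fringe_law f B))%:E.
Proof.
rewrite (_ : fringe_event X U B = XU @^-1` [set x | B (fringe (val x.1) x.2)])//.
rewrite (prob_finite mXU PXU); congr (_%:E).
rewrite /mean mulr_suml -(pair_big_dep xpredT (fun f v => `[< B (fringe (val f) v) >])
  (fun _ _ => D^-1 * (size d)%:R^-1)) /=.
apply: eq_bigr => f _; rewrite sum_const /fringe_law -!mulrA; congr (_ * _).
by rewrite mulrC.
Qed.

Lemma expectation_labtree (h : labtree d -> nat) :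
  'E_P[fun w => (h (X w))%:R]%E = (mean (fun f => (h f)%:R))%:E.
Proof.
rewrite (expectation_finite (q := fun=> D^-1)).
- by rewrite /mean mulr_suml.
- by move=> f; case: (XP f).
- by move=> f; case: (XP f).
Qed.

Lemma cond_prob_fringe_event B w :
  cond_prob P (fringe_event X U B) X w = fringe_law (X w) B.
Proof.
rewrite /cond_prob; have [_ ->] := XP (X w); rewrite -/D /=.
have -> : fringe_event X U B `&` X @^-1` [set X w] =
    XU @^-1` [set x | x.1 = X w /\ B (fringe (val x.1) x.2)].
  by apply/seteqP; split => w' /= [].
rewrite (prob_finite mXU PXU) /=.
rewrite (eq_bigl (fun x => (x.1 == X w) && `[< B (fringe (val x.1) x.2) >])); last first.
  move=> x /=; apply/asboolP/andP => [[-> b]|[/eqP -> /asboolP b]] //.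
  by split; rewrite ?eqxx//; apply/asboolP.
rewrite -(pair_big_dep (pred1 (X w)) (fun f v => `[< B (fringe (val f) v) >])
  (fun _ _ => D^-1 * (size d)%:R^-1)) /= big_pred1_eq sum_const /fringe_law.
by field; rewrite D_neq0 size_neq0.
Qed.

(** Markov's inequality. *)
Lemma prob_labtree_le (h : labtree d -> R) (e : R) : 0 < e ->
  (forall f, 0 <= h f) -> (P [set w | (e <= h (X w))%R] <= (mean h / e)%:E)%E.
Proof.
move=> e0 h0; rewrite (_ : [set w | _] = X @^-1` [set f | e <= h f])//.
have mX f : measurable (X @^-1` [set f]) by case: (XP f).
have PX f : P (X @^-1` [set f]) = (D^-1)%:E by case: (XP f).
rewrite (prob_finite mX PX) lee_fin /mean mulrAC mulr_suml mulr_suml.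
rewrite big_mkcond /=; apply: ler_sum => f _; case: asboolP => [/= le|_].
  by rewrite -[leLHS]mul1r ler_wpM2r ?invr_ge0// ler_pdivlMr// mul1r.
by rewrite mulr_ge0 ?divr_ge0 ?invr_ge0// ltW.
Qed.

End FringeLaw.

Section Limit.
Variables (R : realType) (d : nat -> seq nat) (p : nat -> R).
Hypothesis dd : forall k, degree_sequence (d k).
Hypothesis d_size : size (d k) @[k --> \oo] --> \oo.
Hypothesis p_ge0 : forall i, 0 <= p i.
Hypothesis p_sum : (\sum_(0 <= i <oo) (p i)%:E = 1)%E.
Hypothesis d_stat : forall i,
  (degstat (d k) i)%:R / (size (d k))%:R @[k --> \oo] --> p i.

Lemma cvg_partial_mass : \sum_(i < m) p i @[m --> \oo] --> (1 : R).
Proof.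
have H := @is_cvg_nneseries R (fun i => (p i)%:E) xpredT 0.
have {}H : cvgn (fun n => \sum_(0 <= i < n) (p i)%:E)%E.
  by apply: H => i _ _; rewrite lee_fin; exact: p_ge0.
have {}H : (\sum_(0 <= i < n) (p i)%:E)%E @[n --> \oo] --> (1%:E : \bar R).
  by have := H; rewrite /cvg_to /= p_sum.
have -> : (fun m => \sum_(i < m) p i) = (fun m => fine (\sum_(0 <= i < m) (p i)%:E)%E).
  by apply/funext => m; rewrite sumEFin big_mkord.
exact: fine_cvg H.
Qed.

Lemma sum_degstat_le (l : seq nat) m :
  (\sum_(i < m) i * degstat l i <= sumn l)%N.
Proof.
elim: l => [|x l IH]; first by rewrite big1// => i _; rewrite muln0.
rewrite /degstat /=; under eq_bigr do rewrite mulnDr.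
rewrite big_split leq_add//=.
have [xm|mx] := ltnP x m.
  rewrite (bigD1 (Ordinal xm)) //= eqxx muln1 big1 ?addn0// => i ix.
  rewrite (_ : (x == i) = false) ?muln0//.
  by apply/negbTE; apply: contraNneq ix => xi; apply/eqP/val_inj.
rewrite big1// => i _; rewrite (_ : (x == i) = false) ?muln0//.
by apply/negbTE; apply: contraTneq mx => ->; rewrite -ltnNge.
Qed.

(** Fatou: the degrees of a tree add up to less than its size. *)
Lemma limit_mean_le1 m : \sum_(i < m) i%:R * p i <= 1.
Proof.
have q : \sum_(i < m) i%:R * ((degstat (d k) i)%:R / (size (d k))%:R) @[k --> \oo] -->
   \sum_(i < m) i%:R * p i.
  by apply: cvg_sum_seq => i; apply: cvgM; [exact: cvg_cst|exact: d_stat].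
apply: (cvgr_to_le q); apply: nearW => k; have [n0 ds] := dd k.
under eq_bigr do rewrite mulrA.
rewrite -mulr_suml ler_pdivrMr ?ltr0n// mul1r.
under eq_bigr do rewrite -natrM.
rewrite -natr_sum ler_nat (leq_trans (sum_degstat_le _ _))// ds.
exact: leq_pred.
Qed.

Context dG (OmegaG : measurableType dG) (PG : probability OmegaG R).
Variable xi : seq nat -> OmegaG -> nat.
Hypothesis xi_gw : gw_offspring PG p xi.

Definition gw_law (B : set utree) : R := fine (PG (gw_event xi B)).

Lemma gw_lawE B : PG (gw_event xi B) = (gw_law B)%:E.
Proof.
rewrite /gw_law fineK//; apply: fin_num_measure; exact: (measurable_gw_event xi_gw).
Qed.

(** The total mass is 1 because the tree is finite almost surely. *)
Lemma gw_law_additive : p 1%N != 1 -> additive_prob gw_law.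
Proof.
move=> p1; split=> [B|B C BC|].
- by rewrite fine_ge0.
- apply: EFin_inj; rewrite EFinD -!gw_lawE -measureU.
  + congr (PG _); apply/seteqP; split => w /=.
      by move=> [T [BT|CT] H]; [left|right]; exists T.
    by move=> [[T BT H]|[T CT H]]; exists T => //; [left|right].
  + exact: (measurable_gw_event xi_gw).
  + exact: (measurable_gw_event xi_gw).
  + rewrite !gw_eventE; apply/seteqP; split => w //= [[t Bt m] [t' Ct' m']].
    rewrite -(matches_inj m m') in Ct'.
    by have : (B `&` C) (forget_order t) by []; rewrite BC.
- by rewrite /gw_law (gw_finite p_ge0 xi_gw cvg_partial_mass limit_mean_le1 p1).
Qed.

Let dist k B := mean (fun f : labtree (d k) => `|fringe_law R f B - gw_law B|).

Lemma cvg_dist1 (T : utree) : dist k [set T] @[k --> \oo] --> (0 : R).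
Proof.
have := @cvg_mean_dist R d p dd d_size d_stat T.
rewrite /dist /gw_law (prob_gw_event1 xi_gw) /=.
by under [in X in _ -> X]eq_fun do under eq_fun do rewrite fringe_law1.
Qed.

Lemma gw_law_tight (e : R) : p 1%N != 1 -> 0 < e ->
  exists2 r : seq utree, uniq r & 1 - e <= gw_law [set` r].
Proof.
move=> p1 e0; have := @cvg_weight_first_trees _ _ _ PG p xi xi_gw setT.
rewrite (gw_finite p_ge0 xi_gw cvg_partial_mass limit_mean_le1 p1) /=.
move=> /cvgrPdist_le/(_ e e0)[n _ /(_ n (leqnn n))] /= H.
exists (undup (map forget_order (first_trees setT n))); first exact: undup_uniq.
apply: (@le_trans _ _ (\sum_(t <- first_trees setT n) weight p t)).
  by move: H; rewrite ler_norml => /andP[_]; lra.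
rewrite -lee_fin -gw_lawE -(prob_gw_list xi_gw) ?uniq_first_trees//.
apply: le_measure; rewrite ?inE.
- exact: (measurable_gw_list xi_gw).
- exact: (measurable_gw_event xi_gw).
- move=> w [t tl m]; rewrite gw_eventE; exists t => //=.
  by rewrite mem_undup map_f.
Qed.

Lemma cvg_dist B : p 1%N != 1 -> dist k B @[k --> \oo] --> (0 : R).
Proof.
move=> p1; apply/cvgr0Pnorm_le => e e0.
have e20 : 0 < e / 2 by rewrite divr_gt0.
have [r ur re] := gw_law_tight p1 e20.
have := @cvg_sum_seq R _ r _ _ cvg_dist1; rewrite big1// => /cvgr0Pnorm_le/(_ _ e20).
apply: filterS => k le; rewrite ger0_norm; last first.
  by rewrite -(mean_cst (dd k) (0 : R)); apply: mean_le => f.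
apply: (@le_trans _ _ (\sum_(T <- r) dist k [set T] + e / 2)); last first.
  by have := le_trans (ler_norm _) le; lra.
rewrite /dist -[e / 2](mean_cst (dd k)).
have -> : \sum_(T <- r) mean (fun f : labtree (d k) =>
    `|fringe_law R f [set T] - gw_law [set T]|) =
    mean (fun f : labtree (d k) =>
      \sum_(T <- r) `|fringe_law R f [set T] - gw_law [set T]|).
  by rewrite /mean -mulr_suml exchange_big.
rewrite -meanD; apply: mean_le => f.
by apply: additive_prob_dist => //; [exact: fringe_law_additive|exact: gw_law_additive].
Qed.

Variables (disp : nat -> measure_display)
  (Omega : forall k, measurableType (disp k))
  (P : forall k, probability (Omega k) R)
  (X : forall k, Omega k -> labtree (d k))
  (U : forall k, Omega k -> 'I_(size (d k))).
Hypothesis X_unif : forall k, uniform_element (P k) (@X k).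
Hypothesis U_unif : forall k, cond_uniform_element (P k) (@X k) (@U k).

(** The annealed probability is the mean of the conditional one. *)
Lemma cvg_annealed B : dist k B @[k --> \oo] --> (0 : R) ->
  P k (fringe_event (@X k) (@U k) B) @[k --> \oo] --> PG (gw_event xi B).
Proof.
move=> H; rewrite gw_lawE.
under eq_fun do rewrite (prob_fringe_event (@X_unif _) (@U_unif _)).
apply: cvg_EFin; first exact: nearW.
rewrite /comp /=; apply/cvgrPdist_le => e e0.
have /cvgr0Pnorm_le/(_ _ e0) := H; apply: filterS => k; apply: le_trans.
apply: le_trans (ler_norm _).
rewrite -[gw_law B](mean_cst (dd k)) distrC /mean -mulrBl -sumrB normrM.
rewrite [X in _ * X]ger0_norm ?invr_ge0// ler_wpM2r ?invr_ge0//.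
exact: ler_norm_sum.
Qed.

Lemma cvg_quenched B : dist k B @[k --> \oo] --> (0 : R) ->
  cvg_in_probability P
    (fun k => cond_prob (P k) (fringe_event (@X k) (@U k) B) (@X k)) (gw_law B).
Proof.
move=> H e e0.
have H' : (dist k B / e)%:E @[k --> \oo] --> 0%E.
  apply: cvg_EFin; first exact: nearW.
  by rewrite -(mul0r e^-1); apply: cvgM => //; exact: cvg_cst.
apply: (squeeze_cvge _ (cvg_cst 0%E) H'); apply: nearW => k.
rewrite measure_ge0 /=.
under eq_set do rewrite (cond_prob_fringe_event (dd _) (@X_unif _) (@U_unif _)).
exact: (prob_labtree_le (@X_unif k)).
Qed.

End Limit.

Theorem theorem6p2 (R : realType) (d : nat -> seq nat) (p : nat -> R)
  (d_degseq : forall k, degree_sequence (d k))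
  (d_size : size (d k) @[k --> \oo] --> \oo)
  (p_ge0 : forall i, 0 <= p i)
  (p_sum : (\sum_(0 <= i <oo) (p i)%:E = 1)%E)
  (d_stat : forall i,
     (degstat (d k) i)%:R / (size (d k))%:R @[k --> \oo] --> p i)
  (disp : nat -> measure_display)
  (Omega : forall k, measurableType (disp k))
  (P : forall k, probability (Omega k) R)
  (X : forall k, Omega k -> labtree (d k))
  (U : forall k, Omega k -> 'I_(size (d k)))
  (X_unif : forall k, uniform_element (P k) (X k))
  (U_unif : forall k, cond_uniform_element (P k) (X k) (U k))
  (dispG : measure_display) (OmegaG : measurableType dispG)
  (PG : probability OmegaG R) (xi : seq nat -> OmegaG -> nat)
  (xi_gw : gw_offspring PG p xi) :
  (forall T : utree,
    [/\ PG (gw_event xi [set T]) = (piun p T)%:E,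
        (forall k, P k (fringe_event (X k) (U k) [set T]) =
           'E_(P k)[fun w => (fringe_count T (val (X k w)))%:R] *
           ((size (d k))%:R^-1)%:E)%E,
        P k (fringe_event (X k) (U k) [set T]) @[k --> \oo] -->
          (piun p T)%:E,
        (forall k w,
           cond_prob (P k) (fringe_event (X k) (U k) [set T]) (X k) w =
           (fringe_count T (val (X k w)))%:R / (size (d k))%:R) &
        cvg_in_probability P
          (fun k => cond_prob (P k) (fringe_event (X k) (U k) [set T]) (X k))
          (piun p T)]) /\
  (p 1%N != 1 ->
   forall A : set utree,
     P k (fringe_event (X k) (U k) A) @[k --> \oo] --> PG (gw_event xi A) /\
     cvg_in_probability P
       (fun k => cond_prob (P k) (fringe_event (X k) (U k) A) (X k))
       (fine (PG (gw_event xi A)))).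
Proof.
split=> [T|p1 A]; last first.
  have H := cvg_dist d_degseq d_size p_ge0 p_sum d_stat xi_gw A p1.
  split; first exact: (cvg_annealed d_degseq xi_gw X_unif U_unif H).
  exact: (cvg_quenched d_degseq X_unif U_unif H).
have H := cvg_dist1 d_degseq d_size d_stat xi_gw T.
have piE : gw_law PG xi [set T] = piun p T by rewrite /gw_law (prob_gw_event1 xi_gw).
split.
- exact: (prob_gw_event1 xi_gw).
- move=> k; rewrite (prob_fringe_event (X_unif k) (U_unif k)).
  rewrite (expectation_labtree (X_unif k) (fun f => fringe_count T (val f))) -EFinM.
  rewrite -mean_div; congr (_%:E); congr mean; apply/funext => f.
  exact: fringe_law1.
- rewrite -(prob_gw_event1 xi_gw); exact: (cvg_annealed d_degseq xi_gw X_unif U_unif H).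
- move=> k w; rewrite (cond_prob_fringe_event (d_degseq k) (X_unif k) (U_unif k)).
  exact: fringe_law1.
- rewrite -piE; exact: (cvg_quenched d_degseq X_unif U_unif H).
Qed.
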